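(* Let $(\mathcal Q,\mathcal C)$ be a hereditary cotilting torsion pair in $\mathrm{Mod}\text{-}R$ and let $Q\in\mathcal Q$ be a simple module with injective envelope $E(Q)$ and $\mathcal C$-cover $0\to\mathcal K(E(Q))\to\mathcal C(E(Q))\xrightarrow{c}E(Q)\to0$. Form the pullback of this sequence along $Q\hookrightarrow E(Q)$, obtaining $0\to\mathcal K(E(Q))\xrightarrow{a}F\xrightarrow{b}Q\to0$. Then $b$ is the $\mathcal C$-cover of $Q$; consequently $F=\mathcal C(Q)$, $\mathcal K(Q)=\mathcal K(E(Q))$ and $\mathcal C(E(Q))=E(\mathcal C(Q))$. Furthermore, $a:\mathcal K(Q)\to\mathcal C(Q)$ is a left almost split morphism in $\mathcal C$ and $\mathcal K(Q)$ is a special neg-isolated indecomposable pure-injective module.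
   Context: $R$ is a unital associative ring. A module $C$ is cotilting if $\mathrm{id}\,C\le1$, $\mathrm{Ext}^1_R(C^\kappa,C)=0$ for all cardinals $\kappa$, and there is an exact sequence $0\to C_1\to C_0\to I\to0$ with $C_i$ direct summands of products of copies of $C$, $I$ an injective cogenerator; its torsion pair is $(\mathcal Q,\mathcal C)$, $\mathcal C=\{M:\mathrm{Ext}^1_R(M,C)=0\}$, $\mathcal Q=\{M:\mathrm{Hom}_R(M,C)=0\}$. The pair is hereditary if $\mathcal Q$ is closed under submodules (equivalently $\mathcal C$ closed under injective envelopes). For a module $M$, $\mathcal C(M)\to M$ denotes a $\mathcal C$-cover (a map from a module of $\mathcal C$ through which every map from $\mathcal C$ to $M$ factors, such that every endomorphism $g$ of $\mathcal C(M)$ compatible with the map is an automorphism; it is surjective here) and $\mathcal K(M)$ its kernel. A module is pure-injective if every pure exact sequence starting at it splits. In a full subcategory $\mathcal X$, $f:X\to Y$ is left almost split if it is not a split monomorphism and every $g:X\to Z$ in $\mathcal X$ not a split monomorphism factors as $g=hf$. A pure-injective $N\in\mathcal C$ is special neg-isolated if there is a left almost split morphism $f:N\to N^+$ in the full subcategory of pure-injectives of $\mathcal C$ with $\mathrm{Coker}(f)\notin\mathcal C$. *)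

(* Defs.v *)
(* Modules over a ring S are MathComp left S-modules
   ([lmodType S]); right R-modules (Mod-R) are left R^c-modules. *)
From HB Require Import structures.
From mathcomp Require Import all_boot all_order all_algebra.
From mathcomp Require Import boolp functions.
Set Implicit Arguments. Unset Strict Implicit. Unset Printing Implicit Defensive.
Import GRing.Theory.
Local Open Scope ring_scope.

Section Modules.
Context {S : pzRingType}.
Local Notation mod := (lmodType S).

Definition is_hom {M N : mod} (f : M -> N) : Prop :=
  forall (r : S) (x y : M), f (r *: x + y) = r *: f x + f y.

Definition surj {M N : mod} (f : M -> N) : Prop := forall y, exists x, f x = y.

Definition split_mono {M N : mod} (f : M -> N) : Prop :=
  exists g : N -> M, is_hom g /\ forall x, g (f x) = x.

Definition short_exact {A B C : mod} (f : A -> B) (g : B -> C) : Prop :=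
  [/\ is_hom f, is_hom g, injective f, (forall y, g y = 0 <-> exists x, f x = y)
    & surj g].

Definition Ext1_zero (M N : mod) : Prop :=
  forall (X : mod) (f : N -> X) (g : X -> M), short_exact f g -> split_mono f.

Definition injective_mod (E : mod) : Prop :=
  forall (A B : mod) (f : A -> B) (g : A -> E), is_hom f -> injective f -> is_hom g ->
    exists h : B -> E, is_hom h /\ forall x, h (f x) = g x.

Definition cogenerator (I : mod) : Prop :=
  forall (M : mod) (x : M), x <> 0 -> exists f : M -> I, is_hom f /\ f x <> 0.

Definition summand_of_power (C D : mod) : Prop :=
  exists (J : Type) (s : D -> (J -> C)) (p : (J -> C) -> D),
    [/\ is_hom s, is_hom p & forall x, p (s x) = x].

Definition inj_dim_le1 (C : mod) : Prop :=
  exists (E0 E1 : mod) (f : C -> E0) (g : E0 -> E1),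
    [/\ injective_mod E0, injective_mod E1 & short_exact f g].

Definition cotilting (C : mod) : Prop :=
  [/\ inj_dim_le1 C,
      (forall J : Type, Ext1_zero (J -> C) C)
    & exists (C1 C0 I : mod) (f : C1 -> C0) (g : C0 -> I),
        [/\ summand_of_power C C1, summand_of_power C C0, injective_mod I,
            cogenerator I & short_exact f g]].

(* the torsion pair (Q, C) of C *)
Definition inCf (C M : mod) : Prop := Ext1_zero M C.
Definition inQt (C M : mod) : Prop :=
  forall f : M -> C, is_hom f -> forall x, f x = 0.

Definition hereditary (C : mod) : Prop :=
  forall (M N : mod) (f : N -> M), is_hom f -> injective f -> inQt C M -> inQt C N.

Definition is_submod {M : mod} (P : M -> Prop) : Prop :=
  P 0 /\ forall (r : S) x y, P x -> P y -> P (r *: x + y).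

Definition simple_mod (M : mod) : Prop :=
  (exists x : M, x <> 0) /\
  forall P : M -> Prop, is_submod P -> (forall x, P x -> x = 0) \/ (forall x, P x).

Definition indecomposable (M : mod) : Prop :=
  (exists x : M, x <> 0) /\
  forall P1 P2 : M -> Prop, is_submod P1 -> is_submod P2 ->
    (forall x, P1 x -> P2 x -> x = 0) ->
    (forall x, exists y z, [/\ P1 y, P2 z & x = y + z]) ->
    (forall x, P1 x -> x = 0) \/ (forall x, P2 x -> x = 0).

Definition injective_envelope {A B : mod} (f : A -> B) : Prop :=
  [/\ is_hom f, injective f, injective_mod B &
      forall P : B -> Prop, is_submod P ->
        (forall y, P y -> (exists x, f x = y) -> y = 0) -> forall y, P y -> y = 0].

Definition is_cover (inX : mod -> Prop) {X M : mod} (c : X -> M) : Prop :=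
  [/\ inX X, is_hom c,
      (forall (Y : mod) (g : Y -> M), inX Y -> is_hom g ->
         exists h : Y -> X, is_hom h /\ forall y, c (h y) = g y)
    & forall g : X -> X, is_hom g -> (forall x, c (g x) = c x) -> bijective g].

Definition is_kernel {K X M : mod} (k : K -> X) (c : X -> M) : Prop :=
  [/\ is_hom k, injective k & forall x, c x = 0 <-> exists y, k y = x].

Definition is_cokernel {X Y Z : mod} (f : X -> Y) (q : Y -> Z) : Prop :=
  [/\ is_hom q, surj q & forall y, q y = 0 <-> exists x, f x = y].

Definition is_pullback {F X Q E : mod} (j : F -> X) (b : F -> Q)
    (c : X -> E) (i : Q -> E) : Prop :=
  [/\ is_hom j, is_hom b, (forall z, c (j z) = i (b z)) &
      forall (Y : mod) (u : Y -> X) (v : Y -> Q), is_hom u -> is_hom v ->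
        (forall y, c (u y) = i (v y)) ->
        exists w : Y -> F, [/\ is_hom w, (forall y, j (w y) = u y),
          (forall y, b (w y) = v y) &
          forall w' : Y -> F, is_hom w' -> (forall y, j (w' y) = u y) ->
            (forall y, b (w' y) = v y) -> forall y, w' y = w y]].

Definition left_almost_split (inX : mod -> Prop) {X Y : mod} (f : X -> Y) : Prop :=
  [/\ inX X, inX Y, is_hom f, ~ split_mono f &
      forall (Z : mod) (g : X -> Z), inX Z -> is_hom g -> ~ split_mono g ->
        exists h : Y -> Z, is_hom h /\ forall x, h (f x) = g x].

Definition pure_mono {A B : mod} (f : A -> B) : Prop :=
  [/\ is_hom f, injective f &
      forall (m n : nat) (r : 'I_n -> 'I_m -> S) (a : 'I_n -> A),
        (exists xb : 'I_m -> B, forall i, \sum_(j < m) r i j *: xb j = f (a i)) ->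
        exists xa : 'I_m -> A, forall i, \sum_(j < m) r i j *: xa j = a i].

Definition pure_injective (N : mod) : Prop :=
  forall (M : mod) (f : N -> M), pure_mono f -> split_mono f.

Definition special_neg_isolated (C N : mod) : Prop :=
  [/\ pure_injective N, inCf C N &
      exists (Np : mod) (f : N -> Np),
        left_almost_split (fun M => pure_injective M /\ inCf C M) f /\
        exists (Y : mod) (q : Np -> Y), is_cokernel f q /\ ~ inCf C Y].

End Modules.

(* Main.v *)
(* Torsion-free means cogenerated by C.  Since the pair is hereditary, the
   envelope of C(E(Q)) is torsion-free, so the cover of E(Q) retracts it and
   X = C(E(Q)) is injective.  An endomorphism of F over Q extends to X, where it
   covers an automorphism of E(Q); hence it is bijective and b is a cover.

   Pure-injectivity of K rests on finite type: if no nonzero element of C is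
   killed by a set A of scalars, the same holds for a finite subset of A.  This
   follows, along a well-order of A, from a counting argument in the style of
   Bazzoni: for W well-ordered without maximum, C^W modulo bounded functions is
   torsion-free, as otherwise the power set of the set of branches of a suitable
   tree would embed into that set.  If K is pure in M, purity and finite type
   show that the map M -> E(Q) extending K -> X kills the torsion of M/K; so it
   lifts to X on the torsion-free quotient, which splits K -> M.

   F need not be pure-injective, so the almost split map among pure-injectives
   ends in its double character dual F**, which is torsion-free by finite type. *)
Require Import Defs.
From HB Require Import structures.
From mathcomp Require Import all_boot all_order all_algebra finmap.
From mathcomp Require Import boolp functions classical_sets fsbigop wochoice.
Set Implicit Arguments. Unset Strict Implicit. Unset Printing Implicit Defensive.
Import Order.TTheory GRing.Theory Num.Theory Defs.
Local Open Scope ring_scope.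

(** * Homomorphisms, submodules and quotients *)

Section HomBasics.
Context {S : pzRingType}.
Local Notation mod := (lmodType S).

Section OneHom.
Variables (M N : mod) (f : M -> N).
Hypothesis fh : is_hom f.

Lemma hom0 : f 0 = 0.
Proof. by have := fh 1 0 0; rewrite !scale1r addr0 => /eqP; rewrite addrC -subr_eq subrr => /eqP<-. Qed.
Lemma homD x y : f (x + y) = f x + f y.
Proof. by have := fh 1 x y; rewrite !scale1r. Qed.
Lemma homZ r x : f (r *: x) = r *: f x.
Proof. by have := fh r x 0; rewrite hom0 !addr0. Qed.
Lemma homN x : f (- x) = - f x.
Proof. by rewrite -scaleN1r homZ scaleN1r. Qed.
Lemma homB x y : f (x - y) = f x - f y.
Proof. by rewrite homD homN. Qed.
Lemma hom_inj : (forall x, f x = 0 -> x = 0) -> injective f.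
Proof. by move=> H x y /eqP; rewrite -subr_eq0 -homB => /eqP/H/eqP; rewrite subr_eq0 => /eqP. Qed.
Lemma inj_hom0 : injective f -> forall x, f x = 0 -> x = 0.
Proof. by move=> fi x fx; apply: fi; rewrite hom0. Qed.
Lemma hom_ker_submod : is_submod (fun x => f x = 0).
Proof. by split=> [|r x y fx fy]; rewrite ?hom0 // fh fx fy scaler0 addr0. Qed.
Lemma hom_im_submod : is_submod (fun y => exists x, f x = y).
Proof.
split=> [|r _ _ [x <-] [y <-]]; first by exists 0; rewrite hom0.
by exists (r *: x + y); rewrite fh.
Qed.
End OneHom.

Lemma hom_id (M : mod) : is_hom (fun x : M => x). Proof. by []. Qed.
Lemma hom_cst0 (M N : mod) : is_hom (fun _ : M => 0 : N).
Proof. by move=> r x y; rewrite scaler0 addr0. Qed.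
Lemma hom_comp (M N L : mod) (g : N -> L) (f : M -> N) :
  is_hom g -> is_hom f -> is_hom (fun x => g (f x)).
Proof. by move=> gh fh r x y; rewrite fh gh. Qed.
Lemma hom_add (M N : mod) (f g : M -> N) :
  is_hom f -> is_hom g -> is_hom (fun x => f x + g x).
Proof. by move=> fh gh r x y; rewrite fh gh scalerDr addrACA. Qed.
Lemma hom_sub (M N : mod) (f g : M -> N) :
  is_hom f -> is_hom g -> is_hom (fun x => f x - g x).
Proof. by move=> fh gh r x y; rewrite fh gh scalerBr opprD addrACA. Qed.
Lemma hom_fst (M N : mod) : is_hom (fun x : (M * N)%type => x.1). Proof. by []. Qed.
Lemma hom_snd (M N : mod) : is_hom (fun x : (M * N)%type => x.2). Proof. by []. Qed.
Lemma hom_pair (L M N : mod) (f : L -> M) (g : L -> N) :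
  is_hom f -> is_hom g -> is_hom (fun x => (f x, g x) : (M * N)%type).
Proof. by move=> fh gh r x y; rewrite fh gh. Qed.
Lemma hom_eval (J : Type) (M : mod) (j : J) : is_hom (fun x : J -> M => x j).
Proof. by []. Qed.
Lemma hom_fun (J : Type) (L M : mod) (f : J -> L -> M) :
  (forall j, is_hom (f j)) -> is_hom (fun x => (fun j => f j x) : J -> M).
Proof. by move=> fh r x y; apply/funext => j; rewrite fh. Qed.
Lemma hom_scale (M : mod) (x : M) : is_hom (fun r : S^o => (r : S) *: x).
Proof. by move=> r s t; rewrite scalerDl -scalerA. Qed.

Lemma submod_preim (M N : mod) (f : M -> N) (P : N -> Prop) :
  is_hom f -> is_submod P -> is_submod (fun x => P (f x)).
Proof. by move=> fh [P0 PD]; split=> [|r x y ? ?]; rewrite ?hom0 // fh; apply: PD. Qed.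
Lemma submod_im (M N : mod) (f : M -> N) (P : M -> Prop) :
  is_hom f -> is_submod P -> is_submod (fun y => exists2 x, P x & f x = y).
Proof.
move=> fh [P0 PD]; split=> [|r _ _ [x Px <-] [y Py <-]].
  by exists 0; rewrite ?hom0.
by exists (r *: x + y); [apply: PD|rewrite fh].
Qed.

Section SubmodOps.
Variables (M : mod) (P : M -> Prop).
Hypothesis Ps : is_submod P.
Lemma submodD x y : P x -> P y -> P (x + y).
Proof. by move=> Px Py; have := Ps.2 1 _ _ Px Py; rewrite scale1r. Qed.
Lemma submodZ r x : P x -> P (r *: x).
Proof. by move=> Px; have := Ps.2 r _ _ Px Ps.1; rewrite addr0. Qed.
Lemma submodN x : P x -> P (- x).
Proof. by move=> Px; rewrite -scaleN1r; apply: submodZ. Qed.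
Lemma submodB x y : P x -> P y -> P (x - y).
Proof. by move=> Px Py; apply: submodD => //; apply: submodN. Qed.
End SubmodOps.

End HomBasics.

Section Submodule.
Context {S : pzRingType} (M : lmodType S) (P : M -> Prop).

Definition submod_pred (Ps : is_submod P) : {pred M} := fun x => `[< P x >].

Variable Ps : is_submod P.
Lemma submod_pred_closed : submod_closed (submod_pred Ps).
Proof.
split=> [|r x y /asboolP Px /asboolP Py]; apply/asboolP; first exact: Ps.1.
exact: Ps.2.
Qed.
HB.instance Definition _ :=
  GRing.isSubmodClosed.Build S M (submod_pred Ps) submod_pred_closed.

Record submod := Submod {submod_val : M; _ : submod_val \in submod_pred Ps}.
HB.instance Definition _ := [isSub for submod_val].
HB.instance Definition _ := [Choice of submod by <:].
HB.instance Definition _ := [SubChoice_isSubLmodule of submod by <:].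
End Submodule.

Section Quotient.
Context {S : pzRingType} (M : lmodType S) (P : M -> Prop).

Definition quo_repr (Ps : is_submod P) (x : M) : M :=
  choose (fun y => `[< P (x - y) >]) x.

Variable Ps : is_submod P.
Local Notation cn := (quo_repr Ps).

Lemma quo_reprP x : P (x - cn x).
Proof.
apply/asboolP; apply: (@chooseP _ (fun y => `[< P (x - y) >])).
by apply/asboolP; rewrite subrr; apply: Ps.1.
Qed.

Lemma quo_repr_eq x y : P (x - y) -> cn x = cn y.
Proof.
move=> Pxy; rewrite /quo_repr.
have E : (fun z => `[< P (x - z) >]) =1 (fun z => `[< P (y - z) >]).
  move=> z; apply: asbool_equiv_eq; split=> H.
    by have := submodB Ps H Pxy; rewrite opprB addrC subrKA.
  by have := submodD Ps Pxy H; rewrite subrKA.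
rewrite (eq_choose E); apply: choose_id; apply/asboolP.
  by rewrite -opprB; apply: submodN.
by rewrite subrr; apply: Ps.1.
Qed.

Lemma quo_repr_id x : cn (cn x) = cn x.
Proof. by apply: quo_repr_eq; rewrite -opprB; apply: submodN => //; apply: quo_reprP. Qed.

Record quo := Quo {quo_val : M; _ : cn quo_val == quo_val}.
HB.instance Definition _ := [isSub for quo_val].
HB.instance Definition _ := [Choice of quo by <:].

Definition to_quo (x : M) : quo := Quo (introT eqP (quo_repr_id x)).

Lemma to_quo_eq x y : P (x - y) -> to_quo x = to_quo y.
Proof. by move=> Pxy; apply/val_inj/quo_repr_eq. Qed.
Lemma quo_valK x : to_quo (val x) = x.
Proof. by apply: val_inj; case: x => x /= /eqP. Qed.
Lemma to_quoK x : P (x - val (to_quo x)).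
Proof. exact: quo_reprP. Qed.

Lemma to_quoD x y : to_quo (val (to_quo x) + val (to_quo y)) = to_quo (x + y).
Proof.
apply: to_quo_eq; rewrite -opprB; apply: submodN => //.
by rewrite opprD addrACA; apply: submodD => //; apply: to_quoK.
Qed.
Lemma to_quoZ r x : to_quo (r *: val (to_quo x)) = to_quo (r *: x).
Proof.
apply: to_quo_eq; rewrite -scalerBr; apply: submodZ => //.
by rewrite -opprB; apply: submodN => //; apply: to_quoK.
Qed.

Definition quo_add (x y : quo) := to_quo (val x + val y).
Definition quo_opp (x : quo) := to_quo (- val x).
Definition quo_scale (r : S) (x : quo) := to_quo (r *: val x).

Lemma quo_addA : associative quo_add.
Proof.
move=> x y z; rewrite /quo_add -{1}(quo_valK x) -{2}(quo_valK z).
by rewrite !to_quoD addrA.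
Qed.
Lemma quo_addC : commutative quo_add.
Proof. by move=> x y; rewrite /quo_add addrC. Qed.
Lemma quo_add0 : left_id (to_quo 0) quo_add.
Proof. by move=> x; rewrite /quo_add -{1}(quo_valK x) to_quoD add0r quo_valK. Qed.
Lemma quo_addN : left_inverse (to_quo 0) quo_opp quo_add.
Proof.
by move=> x; rewrite /quo_add /quo_opp -{2}(quo_valK x) to_quoD addNr.
Qed.
HB.instance Definition _ :=
  GRing.isZmodule.Build quo quo_addA quo_addC quo_add0 quo_addN.

Lemma quo_scaleA a b v : quo_scale a (quo_scale b v) = quo_scale (a * b) v.
Proof. by rewrite /quo_scale to_quoZ scalerA. Qed.
Lemma quo_scale1 : left_id 1 quo_scale.
Proof. by move=> v; rewrite /quo_scale scale1r quo_valK. Qed.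
Lemma quo_scaleDr : right_distributive quo_scale +%R.
Proof.
move=> a x y; rewrite /quo_scale [x + y]/(quo_add x y) /quo_add to_quoZ scalerDr.
by rewrite [RHS]/(quo_add _ _) /quo_add to_quoD.
Qed.
Lemma quo_scaleDl v : {morph quo_scale^~ v : a b / a + b}.
Proof.
by move=> a b; rewrite /quo_scale scalerDl [RHS]/(quo_add _ _) /quo_add to_quoD.
Qed.
HB.instance Definition _ := GRing.Zmodule_isLmodule.Build S quo
  quo_scaleA quo_scale1 quo_scaleDr quo_scaleDl.

Lemma to_quo_hom : is_hom to_quo.
Proof.
move=> r x y; rewrite [RHS]/(quo_add (quo_scale _ _) _) /quo_add /quo_scale.
by rewrite to_quoZ to_quoD.
Qed.
Lemma to_quo0 x : to_quo x = 0 <-> P x.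
Proof.
split=> [/(congr1 val) /= H|Px]; last by apply: to_quo_eq; rewrite subr0.
have := submodB Ps (to_quoK x) (to_quoK 0).
rewrite sub0r opprK /= H; rewrite addrNK; exact.
Qed.
End Quotient.

Section SubQuo.
Context {S : pzRingType}.
Local Notation mod := (lmodType S).

Lemma submodule_exists (M : mod) (P : M -> Prop) : is_submod P ->
  exists (A : mod) (e : A -> M),
    [/\ is_hom e, injective e & forall x, P x <-> exists a, e a = x].
Proof.
move=> Ps; exists (submod Ps), (@submod_val _ _ _ Ps).
split; [by [] | exact: val_inj |].
move=> x; split=> [Px | [[y /= /asboolP Py] <-] //].
by exists (Submod (introT (asboolP _) Px : x \in submod_pred Ps)).
Qed.

Lemma quotient_exists (M : mod) (P : M -> Prop) : is_submod P ->
  exists (B : mod) (q : M -> B),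
    [/\ is_hom q, surj q & forall x, q x = 0 <-> P x].
Proof.
move=> Ps; exists (quo Ps), (to_quo Ps); split; first exact: to_quo_hom.
  by move=> y; exists (val y); apply: quo_valK.
exact: to_quo0.
Qed.

Lemma factor_mono (Y A M : mod) (e : A -> M) (f : Y -> M) :
  is_hom e -> injective e -> is_hom f -> (forall y, exists a, e a = f y) ->
  exists g : Y -> A, is_hom g /\ forall y, e (g y) = f y.
Proof.
move=> eh ei fh /choice[g gE]; exists g; split=> // r x y.
by apply: ei; rewrite eh !gE fh.
Qed.

Lemma factor_epi (M B Y : mod) (q : M -> B) (f : M -> Y) :
  is_hom q -> surj q -> is_hom f -> (forall x, q x = 0 -> f x = 0) ->
  exists g : B -> Y, is_hom g /\ forall x, g (q x) = f x.
Proof.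
move=> qh /choice[s sE] fh fq.
have E x : f (s (q x)) = f x.
  by apply/eqP; rewrite -subr_eq0 -homB //; apply/eqP/fq; rewrite homB // sE subrr.
exists (fun y => f (s y)); split=> // r x y.
by rewrite -{1}(sE x) -{1}(sE y) -qh E fh.
Qed.

End SubQuo.

(** * Ext and torsion-free modules *)

Section Ext.
Context {S : pzRingType}.
Local Notation mod := (lmodType S).

(** The pullback of the sequence along [u] is an extension of [M] by [N]; it splits, and the section
    followed by the projection to [B] is the lift. *)
Lemma Ext1_zero_lift (M N B D : mod) (f : N -> B) (g : B -> D) (u : M -> D) :
  Ext1_zero M N -> short_exact f g -> is_hom u ->
  exists v : M -> B, is_hom v /\ forall x, g (v x) = u x.
Proof.
move=> MN [fh gh fi ker gs] uh.
pose d (p : (M * B)%type) := g p.2 - u p.1.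
have dh : is_hom d by apply: hom_sub => r x y; rewrite /= ?gh ?uh.
have [A [e [eh ei eP]]] := submodule_exists (hom_ker_submod dh).
have [f' [f'h f'E]] : exists f' : N -> A,
    is_hom f' /\ forall n, e (f' n) = (0, f n).
  apply: factor_mono => // [|n]; first by apply: hom_pair => //; apply: hom_cst0.
  apply/eP; rewrite /d /= hom0 // subr0; apply/ker; by exists n.
have [|r [rh rE]] := MN A f' (fun x => (e x).1).
  split=> //; first by move=> ???; rewrite eh.
  - by move=> x y /(congr1 e); rewrite !f'E => -[] /fi.
  - move=> y; split=> [y1|[x <-]]; last by rewrite f'E.
    have : d (e y) = 0 by apply/eP; exists y.
    rewrite /d y1 hom0 // subr0 => /ker[n nE]; exists n; apply: ei.
    by rewrite f'E nE -y1; case: (e y).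
  - move=> x; have [b bE] := gs (u x).
    have /eP[y yE] : d (x, b) = 0 by rewrite /d /= bE subrr.
    by exists y; rewrite yE.
have gE y : g (e y).2 = u (e y).1.
  by apply/eqP; rewrite -subr_eq0; apply/eqP/(eP (e y)); exists y.
have surj1 : surj (fun x => (e x).1).
  move=> x; have [b bE] := gs (u x).
  have /eP[y yE] : d (x, b) = 0 by rewrite /d /= bE subrr.
  by exists y; rewrite yE.
have [|v [vh vE]] := factor_epi (hom_comp (@hom_fst _ M B) eh) surj1
    (hom_comp (@hom_snd _ M B) (hom_comp eh (hom_sub (@hom_id _ A) (hom_comp f'h rh)))).
  move=> y y1; have : d (e y) = 0 by apply/eP; exists y.
  rewrite /d y1 hom0 // subr0 => /ker[n nE].
  have -> : y = f' n by apply: ei; rewrite f'E nE -y1; case: (e y).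
  by rewrite rE subrr hom0.
exists v; split=> // x; have [y <-] := surj1 x.
by rewrite vE gE homB // f'E /= subr0.
Qed.

(** A map extending [f] along the given extension induces [u] from [M] to [E1]; subtracting a lift
    of [u] brings the extended map back into [N]. *)
Lemma Ext1_zero_of_lift (M N E0 E1 : mod) (f : N -> E0) (g : E0 -> E1) :
  injective_mod E0 -> short_exact f g ->
  (forall u : M -> E1, is_hom u ->
     exists v : M -> E0, is_hom v /\ forall x, g (v x) = u x) ->
  Ext1_zero M N.
Proof.
move=> E0i [fh gh fi ker gs] lift X k p [kh ph ki kerp ps].
have [w [wh wE]] := E0i _ _ k f kh ki fh.
have [|u [uh uE]] := factor_epi ph ps (hom_comp gh wh).
  by move=> x /kerp[n <-]; rewrite wE; apply/ker; exists n.
have [v [vh vE]] := lift u uh.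
have [|r [rh rE]] := factor_mono fh fi (hom_sub wh (hom_comp vh ph)).
  by move=> x; apply/ker; rewrite homB // vE uE subrr.
exists r; split=> // n; apply: fi; rewrite rE wE.
by have /kerp -> : exists n', k n' = k n; [exists n|rewrite hom0 // subr0].
Qed.

(** [u] extends with values in [E0]; the obstruction is a map from [M] to [E1], and its lift to [E0]
    is the correction. *)
Lemma Ext1_zero_extend (M N A B : mod) (f : A -> B) (g : B -> M) (u : A -> N) :
  inj_dim_le1 N -> Ext1_zero M N -> short_exact f g -> is_hom u ->
  exists v : B -> N, is_hom v /\ forall x, v (f x) = u x.
Proof.
move=> [E0 [E1 [d0 [d1 [E0i _ dex]]]]] MN [fh gh fi ker gs] uh.
have [d0h d1h d0i dker ds] := dex.
have [w [wh wE]] := E0i _ _ f (fun x => d0 (u x)) fh fi (hom_comp d0h uh).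
have [|t [th tE]] := factor_epi gh gs (hom_comp d1h wh).
  by move=> x /ker[n <-]; rewrite wE; apply/dker; exists (u n).
have [s [sh sE]] := Ext1_zero_lift MN dex th.
have [|r [rh rE]] := factor_mono d0h d0i (hom_sub wh (hom_comp sh gh)).
  by move=> x; apply/dker; rewrite homB // sE tE subrr.
exists r; split=> // n; apply: d0i; rewrite rE wE.
by have /ker -> : exists n', f n' = f n; [exists n|rewrite hom0 // subr0].
Qed.

Lemma Ext1_zero_summand_of_power (M C D : mod) :
  inj_dim_le1 C -> Ext1_zero M C -> summand_of_power C D -> Ext1_zero M D.
Proof.
move=> id1 MC [J [s [p [sh ph ps]]]] X f g ex.
have [fh _ _ _ _] := ex.
have sjh j : is_hom (fun x => s x j) by move=> r x y; rewrite sh.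
have /choice[v vP] j := Ext1_zero_extend id1 MC ex (sjh j).
exists (fun x => p (fun j => v j x)); split.
  by apply: hom_comp => //; apply: hom_fun => j; have [] := vP j.
move=> x; rewrite -[RHS]ps; congr p; apply/funext => j; by have [_ ->] := vP j.
Qed.

Lemma injective_mod_fun (J : Type) (I : mod) :
  injective_mod I -> injective_mod (J -> I).
Proof.
move=> Ii A B f g fh fi gh.
have gjh j : is_hom (fun x => g x j) by move=> r x y; rewrite gh.
have /choice[v vP] j := Ii _ _ f _ fh fi (gjh j).
exists (fun x j => v j x); split; first by apply: hom_fun => j; have [] := vP j.
by move=> x; apply/funext => j; have [_ ->] := vP j.
Qed.

Lemma injective_mod_retract (G X : mod) (e : X -> G) (p : G -> X) :
  is_hom e -> is_hom p -> (forall x, p (e x) = x) ->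
  injective_mod G -> injective_mod X.
Proof.
move=> eh ph pe Gi A B f g fh fi gh.
have [h [hh hE]] := Gi _ _ f (fun x => e (g x)) fh fi (hom_comp eh gh).
by exists (fun x => p (h x)); split=> [|x]; [apply: hom_comp|rewrite hE pe].
Qed.

Lemma Ext1_zero_regular (N : mod) : inj_dim_le1 N -> Ext1_zero (S^o : mod) N.
Proof.
move=> [E0 [E1 [d0 [d1 [E0i _ dex]]]]]; apply: (Ext1_zero_of_lift E0i dex).
move=> u uh; have [_ d1h _ _ ds] := dex; have [e eE] := ds (u 1).
exists (fun r : S^o => (r : S) *: e); split; first exact: hom_scale.
by move=> r; rewrite homZ // eE -homZ // [_ *: _]mulr1.
Qed.

End Ext.

(** * The torsion radical and torsion-free modules *)

Section Radical.
Context {S : pzRingType}.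
Local Notation mod := (lmodType S).
Variable C : mod.

(** The reject of [C] in [M]; for cotilting [C] it is the torsion submodule. *)
Definition torrad (M : mod) (x : M) : Prop := forall f : M -> C, is_hom f -> f x = 0.
Definition separated (M : mod) : Prop := forall x : M, torrad x -> x = 0.

Lemma torrad_submod (M : mod) : is_submod (@torrad M).
Proof.
by split=> [f fh|r x y Rx Ry f fh]; rewrite ?hom0 // fh Rx // Ry // scaler0 addr0.
Qed.

Lemma torrad_hom (M N : mod) (f : M -> N) x : is_hom f -> torrad x -> torrad (f x).
Proof. by move=> fh Rx g gh; apply: (Rx (fun x => g (f x))); apply: hom_comp. Qed.

Lemma separated_mono (M N : mod) (f : M -> N) :
  is_hom f -> injective f -> separated N -> separated M.
Proof. by move=> fh fi Ns x /(torrad_hom fh)/Ns/(inj_hom0 fh fi). Qed.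

Lemma separated_fun (J : Type) (M : mod) : separated M -> separated (J -> M).
Proof.
move=> Ms x Rx; apply/funext => j; apply: Ms.
exact: (torrad_hom (@hom_eval _ _ _ j)).
Qed.

Lemma separated_self : separated C.
Proof. by move=> x; apply; apply: hom_id. Qed.

Lemma separated_quotient (M B : mod) (q : M -> B) (P : M -> Prop) :
  is_hom q -> surj q -> (forall x, q x = 0 <-> P x) ->
  (forall x, (forall f : M -> C, is_hom f -> (forall y, P y -> f y = 0) -> f x = 0) ->
     P x) ->
  separated B.
Proof.
move=> qh qs qP HP y; have [x <-] := qs y => Rx; apply/qP/HP => f fh fP.
have [|g [gh <-]] := factor_epi qh qs fh; last exact: Rx.
by move=> z /qP/fP.
Qed.

Hypothesis Ccot : cotilting C.

(** Forward: a map to the cogenerator [I] lifts to [C0], because Ext into [C1] vanishes, and [C0]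
    sits in a power of [C]. Backward: [M] embeds in a power of [C], to which maps into [E1] extend
    and from which they lift to [E0]. *)
Lemma inCf_separated (M : mod) : inCf C M <-> separated M.
Proof.
have [id1 Cpow [C1 [C0 [I [f [g [C1s C0s Ii Ic fg]]]]]]] := Ccot.
split=> [MC x Rx|Ms].
  apply: contrapT => /Ic[h [hh]]; apply.
  have [v [vh vE]] := Ext1_zero_lift (Ext1_zero_summand_of_power id1 MC C1s) fg hh.
  have [J [s [p [sh ph ps]]]] := C0s.
  have C0sep : separated C0.
    apply: (separated_mono sh); first by move=> ? ? /(congr1 p); rewrite !ps.
    exact/separated_fun/separated_self.
  have [_ gh _ _ _] := fg.
  by rewrite -vE (C0sep (v x)) ?hom0 //; apply: torrad_hom.
have [E0 [E1 [d0 [d1 [E0i E1i dex]]]]] := id1.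
apply: (Ext1_zero_of_lift E0i dex) => u uh.
pose J := {f : M -> C | is_hom f}.
pose e (x : M) : J -> C := fun j => sval j x.
have eh : is_hom e by apply: hom_fun => -[].
have ei : injective e.
  apply: (hom_inj eh) => x ex; apply: Ms => k kh.
  by have /(congr1 (@^~ (exist _ k kh))) := ex.
have [w [wh wE]] := E1i _ _ e u eh ei uh.
have [v [vh vE]] := Ext1_zero_lift (Cpow J) dex wh.
by exists (fun x => v (e x)); split=> [|x]; [apply: hom_comp|rewrite vE].
Qed.

(** The quotient by the radical is torsion-free, so maps from the radical to [C] extend to [M],
    where they vanish on it. *)
Lemma torrad_torsion (M A : mod) (e : A -> M) :
  is_hom e -> injective e -> (forall x, torrad x <-> exists a, e a = x) -> inQt C A.
Proof.
move=> eh ei eP f fh x.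
have [B [q [qh qs qP]]] := quotient_exists (torrad_submod M).
have Bs : separated B.
  by apply: (separated_quotient qh qs qP) => y Hy h hh; apply: Hy => // z; apply.
have id1 : inj_dim_le1 C by case: Ccot.
have [|v [vh <-]] := Ext1_zero_extend id1 (iffRL (inCf_separated B) Bs) (f := e) (g := q) _ fh.
  by split=> // y; rewrite qP eP.
by have : torrad (e x) by [apply/eP; exists x]; apply.
Qed.

Hypothesis Cher : hereditary C.

(** By heredity the cyclic module generated by [x] is torsion, and sending [r *: x] to [r *: z] is a
    well-defined map from it to [C]. *)
Lemma torrad_elt (M : mod) (x : M) (z : C) :
  torrad x -> (forall r : S, r *: x = 0 -> r *: z = 0) -> z = 0.
Proof.
move=> Rx H.
have [A [e [eh ei eP]]] := submodule_exists (torrad_submod M).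
have At := torrad_torsion eh ei eP.
have xh := hom_scale x.
have [A' [e' [e'h e'i e'P]]] := submodule_exists (hom_im_submod xh).
have [|j [jh jE]] := factor_mono eh ei e'h.
  move=> a; apply/eP; have /e'P[r <-] : exists a', e' a' = e' a by exists a.
  exact: (submodZ (torrad_submod M)).
have ji : injective j by move=> a a' /(congr1 e); rewrite !jE => /e'i.
have A't := Cher jh ji At.
have [|q [qh qE]] := factor_mono e'h e'i xh; first by move=> r; apply/e'P; exists r.
have qs : surj q.
  move=> a; have /e'P[r rE] : exists a', e' a' = e' a by exists a.
  by exists r; apply: e'i; rewrite qE.
have [|g [gh gE]] := factor_epi qh qs (hom_scale z).
  by move=> r /(congr1 e'); rewrite qE hom0 // => /H.
have := gE 1; rewrite scale1r => <-; exact: A't.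
Qed.

End Radical.

(** * Finite type of the torsion pair *)

(** Summing the coordinates in [Z] makes sense for finite support; injectivity of [E] extends this
    map to all functions. *)
Lemma partial_sum_hom {S : pzRingType} (E : lmodType S) (B : choiceType)
    (Z : B -> Prop) : injective_mod E ->
  exists s : (B -> E) -> E, is_hom s /\
    forall b (x : B -> E), (forall b', b' <> b -> x b' = 0) ->
      (Z b -> s x = x b) /\ (~ Z b -> s x = 0).
Proof.
move=> Ei.
pose P (x : B -> E) := exists D : {fset B}, forall b, b \notin D -> x b = 0.
pose th (x : B -> E) := \sum_(b \in [set: B]) (if `[< Z b >] then x b else 0).
have thE (D : {fset B}) (x : B -> E) : (forall b, b \notin D -> x b = 0) ->
    th x = \sum_(b <- D) (if `[< Z b >] then x b else 0).
  move=> xD; rewrite /th (fsbigTE D) // => b /xD ->; by rewrite if_same.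
have PU (x y : B -> E) : P x -> P y -> exists D : {fset B},
    (forall b, b \notin D -> x b = 0) /\ (forall b, b \notin D -> y b = 0).
  move=> [D xD] [D' yD]; exists (D `|` D')%fset.
  split=> b; rewrite in_fsetU negb_or => /andP[]; auto.
have Ps : is_submod P.
  split=> [|r x y Px Py]; first by exists fset0.
  have [D [xD yD]] := PU _ _ Px Py; exists D => b bD.
  by rewrite -[LHS]/(r *: x b + y b) xD // yD // scaler0 addr0.
have [A [e [eh ei eP]]] := submodule_exists Ps.
have Pe a : P (e a) by apply/eP; exists a.
have th_hom : is_hom (fun a => th (e a)).
  move=> r a a'; have [D [xD yD]] := PU _ _ (Pe a) (Pe a').
  have xyD b : b \notin D -> e (r *: a + a') b = 0.
    by move=> bD; rewrite eh -[LHS]/(r *: e a b + e a' b) xD // yD // scaler0 addr0.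
  rewrite !(thE D) // scaler_sumr -big_split /=; apply: eq_bigr => b _.
  by rewrite eh; case: ifP => // _; rewrite scaler0 addr0.
have [s [sh sE]] := Ei _ _ e _ eh ei th_hom.
exists s; split=> // b x xb.
have xb' b' : b' \notin [fset b]%fset -> x b' = 0.
  by rewrite in_fset1 => /eqP; apply: xb.
have /eP[a aE] : P x by exists [fset b]%fset.
have -> : s x = (if `[< Z b >] then x b else 0).
  by rewrite -aE sE (thE [fset b]%fset) aE // big_seq_fset1.
by split=> [/asboolP -> //|]; case: asboolP.
Qed.

Lemma existT_inj_irr (T : Type) (P : T -> Type) (x : T) (u v : P x) :
  existT P x u = existT P x v -> u = v.
Proof.
by move=> E; have := projT2_eq E; rewrite (Prop_irrelevance (projT1_eq E) erefl).
Qed.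

(** * A tree on a well-founded order *)

Section Tree.
Variables (W : Type) (lt : W -> W -> Prop) (wf : well_founded lt) (H : Type).
Hypothesis lt_trans : forall u v w, lt u v -> lt v w -> lt u w.

(* A node at level [w] is a set of pairs (node below [w], element of [H]), and a
   branch is a set of pairs (node, element of [H]); a branch passes at level [w]
   through its restriction.  So there are as many branches as sets of pairs. *)
Fixpoint level (w : W) (a : Acc lt w) {struct a} : Type :=
  {v : W & {l : lt v w & level (Acc_inv a l)}} * H -> Prop.

Definition node : Type := {w : W & {a : Acc lt w & level a}}.
Definition mknode w (a : Acc lt w) (t : level a) : node :=
  existT _ w (existT _ a t).
Definition branch : Type := node * H -> Prop.

Definition restr (f : branch) (w : W) (a : Acc lt w) : level a :=
  match a as a0 return level a0 with
  | Acc_intro h => fun p =>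
      f (mknode (projT2 (projT2 p.1)), p.2)
  end.

Lemma restr_eq (f g : branch) w (a : Acc lt w) :
  restr f a = restr g a <->
  forall v, lt v w -> forall (b : Acc lt v) (t : level b) h,
    f (mknode t, h) = g (mknode t, h).
Proof.
case: a => k; split=> [E v l b t h|E].
  move: t; rewrite (Prop_irrelevance b (k v l)) => t.
  by have /(congr1 (@^~ (existT _ v (existT _ l t), h))) := E.
by apply/funext => -[[v [l t]] h] /=; apply: E.
Qed.

Definition on_branch (f : branch) (w : W) : node := mknode (restr f (wf w)).

Lemma on_branch_inj f g w w' : on_branch f w = on_branch g w' -> w = w'.
Proof. by move/(congr1 (@projT1 _ _)). Qed.

Lemma on_branch_eq f g w : on_branch f w = on_branch g w <->
  forall v, lt v w -> forall (b : Acc lt v) (t : level b) h,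
    f (mknode t, h) = g (mknode t, h).
Proof.
rewrite -(restr_eq f g (wf w)); split=> [|E]; last by rewrite /on_branch E.
rewrite /on_branch /mknode => E.
exact: existT_inj_irr (existT_inj_irr E).
Qed.

Lemma on_branch_le f g v w :
  lt v w -> on_branch f w = on_branch g w -> on_branch f v = on_branch g v.
Proof.
move=> vw /on_branch_eq E; apply/on_branch_eq => u uv; apply: E.
exact: lt_trans vw.
Qed.

(** Distinct branches differ at some labelled node, of level [v] say, and their restrictions to all
    levels above [v] show this. *)
Lemma on_branch_sep f g : f <> g ->
  exists v, forall w, lt v w -> on_branch f w <> on_branch g w.
Proof.
move=> fg; apply: contrapT => nE; apply: fg; apply/funext => -[[v [b t]] h].
apply: contrapT => ne; apply: nE; exists v => w vw /on_branch_eq/(_ v vw b t h).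
exact: ne.
Qed.

End Tree.

(** * Lifting maps that vanish on bounded sequences *)

Section Chain.
Context {S : pzRingType} (C E0 E1 : lmodType S) (d0 : C -> E0) (d1 : E0 -> E1).
Hypotheses (E1i : injective_mod E1) (dex : short_exact d0 d1).
Hypothesis Cpow : forall J : Type, Ext1_zero (J -> C) C.
Variables (W : Type) (lt : W -> W -> Prop) (wf : well_founded lt).
Hypothesis lt_trans : forall u v w, lt u v -> lt v w -> lt u w.
Hypothesis lt_total : forall v w, [\/ lt v w, v = w | lt w v].
Hypothesis lt_nomax : forall w, exists v, lt w v.

Definition bounded (y : W -> C) := exists w, forall v, ~ lt v w -> y v = 0.

Lemma bounded_submod : inhabited W -> is_submod bounded.
Proof.
move=> [w0]; split=> [|r x y [w xw] [w' yw]]; first by exists w0.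
have lin v : x v = 0 -> y v = 0 -> (r *: x + y) v = 0.
  by move=> xv yv; rewrite -[LHS]/(r *: x v + y v) xv yv scaler0 addr0.
case: (lt_total w w') => [ww'|ww'|w'w].
- exists w' => v vw'; apply: lin; last exact: yw.
  by apply: xw => vw; apply: vw'; apply: lt_trans ww'.
- by exists w => v vw; apply: lin; [apply: xw|apply: yw; rewrite -ww'].
- exists w => v vw; apply: lin; first exact: xw.
  by apply: yw => vw'; apply: vw; apply: lt_trans w'w.
Qed.

Let H := (W -> C) -> C.
Local Notation B := (branch lt H).
Local Notation T := (node lt H).

(** A sequence is written along one branch and zero elsewhere, so that all branches share the single
    power of [C] indexed by the nodes. *)
Let spread (f : B) (y : W -> C) : T -> C :=
  fun t => if `[< t = on_branch wf f (projT1 t) >] then y (projT1 t) else 0.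
Let trunc (w : W) (y : W -> C) : W -> C := fun v => if `[< lt v w >] then y v else 0.

Lemma spread_hom f : is_hom (spread f).
Proof.
move=> r x y; apply/funext => t; rewrite -[RHS]/(r *: spread f x t + spread f y t) /spread.
by case: asboolP => // _; rewrite scaler0 addr0.
Qed.
Lemma spread_on_branch f g y w : spread f y (on_branch wf g w) =
  if `[< on_branch wf g w = on_branch wf f w >] then y w else 0.
Proof. by []. Qed.

Lemma spread_trunc_eq f g w y : on_branch wf f w = on_branch wf g w ->
  spread f (trunc w y) = spread g (trunc w y).
Proof.
move=> fg; apply/funext => t; rewrite /spread /trunc; case: (asboolP (lt _ w)).
  by move=> /(on_branch_le lt_trans)/(_ fg) ->.
by rewrite !if_same.
Qed.

(** Every set [Z] of branches gives a map on functions on the nodes that lifts [phi] along the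
    branches in [Z] and zero along the others. Its values on truncated sequences give a code; were
    two codes equal, the difference of the two maps along a branch in one set only would be the
    required lift. There are not enough branches for all codes to differ. *)
Lemma bounded_hom_lift (phi : (W -> C) -> E1) : is_hom phi ->
  (forall y, bounded y -> phi y = 0) ->
  exists s : (W -> C) -> E0, [/\ is_hom s, (forall y, bounded y -> s y = 0)
    & forall y, d1 (s y) = phi y].
Proof.
move=> phih phib; apply: contrapT => nos.
have [d0h d1h d0i dker ds] := dex.
have lift (Z : B -> Prop) : exists th : (T -> C) -> E0, is_hom th /\
    forall f y, (Z f -> d1 (th (spread f y)) = phi y) /\
                (~ Z f -> d1 (th (spread f y)) = 0).
  have [s [sh sE]] := @partial_sum_hom S E1 {classic B} Z E1i.
  pose Phi (x : T -> C) : {classic B} -> E1 :=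
    fun f => phi (fun w => x (on_branch wf f w)).
  have Phih : is_hom Phi.
    by apply: hom_fun => f; apply: hom_comp => //; apply: hom_fun.
  have [th [thh thE]] := Ext1_zero_lift (@Cpow T) dex (hom_comp sh Phih).
  exists th; split=> // f y; rewrite thE.
  have PhiE : Phi (spread f y) f = phi y.
    congr phi; apply/funext => w; rewrite spread_on_branch.
    by case: asboolP.
  (* Another branch shares with [f] only a bounded set of levels, so [phi] kills what it sees of
     [spread f y]; only the coordinate [f] remains. *)
  have [|H1 H2] := sE f (Phi (spread f y)).
    move=> g gf; apply: phib; have [v vP] := on_branch_sep wf gf.
    have [u vu] := lt_nomax v; exists u => w nwu.
    rewrite spread_on_branch; case: asboolP => // /vP[].
    by case: (lt_total w u) nwu => [//|->//|uw _]; apply: lt_trans uw.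
  by rewrite -PhiE.
have [Th ThP] := choice lift.
have /choice[r rP] x : exists y, d1 x = 0 -> d0 y = x.
  by have [/dker[y yx]|] := pselect (d1 x = 0); [exists y|exists 0].
pose val Z f w : H := fun y => r (Th Z (spread f (trunc w y))).
pose code (Z : B -> Prop) : B := fun p => exists f w,
  p.1 = on_branch wf f w /\ p.2 = val Z f w.
(* [code] would embed the power set of [B] into [B], against Cantor. *)
have code_inj Z Z' : code Z = code Z' -> forall f, Z f -> Z' f.
  move=> E f Zf; apply: contrapT => nZ'f; apply: nos.
  have [Thh ThE] := ThP Z; have [Thh' ThE'] := ThP Z'.
  have truncE y w : (forall v, ~ lt v w -> y v = 0) -> trunc w y = y.
    move=> yw; apply/funext => v; rewrite /trunc; case: asboolP => // /yw -> //.
  exists (fun y => Th Z (spread f y) - Th Z' (spread f y)); split.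
  - by apply: hom_sub; apply: hom_comp => //; apply: spread_hom.
  - move=> y yb; have yphi := phib _ yb; have [w yw] := yb.
    have : code Z (on_branch wf f w, val Z f w) by exists f, w.
    rewrite E => -[g [w' /= [gE vE]]].
    (* Equal nodes have equal levels, and below that level [f] and [g] run through the same nodes,
       so the labels compare both lifts on one spread sequence. *)
    have ww' := on_branch_inj gE; subst w'.
    have /(congr1 (@^~ y)) : val Z f w = val Z' g w by [].
    rewrite /val -(spread_trunc_eq _ gE) truncE // => /(congr1 d0).
    rewrite !rP; first by move=> ->; rewrite subrr.
    + by case: (ThE' f y) => _ ->.
    + by case: (ThE f y) => ->.
  - move=> y; rewrite homB //; case: (ThE f y) => -> // _.
    by case: (ThE' f y) => _ -> //; rewrite subr0.
pose D : B -> Prop := fun b => exists Z, b = code Z /\ ~ Z b.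
have nD : ~ D (code D).
  move=> DD; have [Z [E nZ]] := DD; apply: nZ; exact: (code_inj _ _ E).
by apply: (nD); exists D.
Qed.

End Chain.

Lemma well_founded_min (T : Type) (lt : T -> T -> Prop) (P : T -> Prop) :
  well_founded lt -> (exists x, P x) ->
  exists z, P z /\ forall x, P x -> ~ lt x z.
Proof.
move=> wf [x Px]; apply: contrapT => no.
elim/(well_founded_ind wf): x Px => x IH Px; apply: no; exists x; split=> // y Py yx.
exact: IH yx Py.
Qed.

Lemma well_founded_total_order (T : eqType) : exists lt : T -> T -> Prop,
  [/\ well_founded lt, (forall u v w, lt u v -> lt v w -> lt u w)
    & forall v w, [\/ lt v w, v = w | lt w v]].
Proof.
have [R Rwo] := well_ordering_principle T.
have Rmin (P : T -> Prop) : (exists x, P x) ->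
    exists z, P z /\ forall x, P x -> R z x.
  move=> [x Px]; have [|z [[Pz zP] _]] := Rwo (fun x => `[< P x >]).
    by exists x; apply/asboolP.
  by exists z; split=> [|y Py]; [exact/asboolP|apply: zP; apply/asboolP].
have Rtot x y : R x y \/ R y x.
  have [|z [[->|->] zP]] := Rmin (fun z => z = x \/ z = y); first by exists x; left.
    by left; apply: zP; right.
  by right; apply: zP; left.
have Rxx x : R x x by case: (Rtot x x).
have Ranti x y : R x y -> R y x -> x = y.
  move=> xy yx; have [|z [_ zU]] := Rwo (pred2 x y); first by exists x; rewrite inE eqxx.
  rewrite -(zU x) ?(zU y) //; split; rewrite ?inE ?eqxx ?orbT // => w.
    by rewrite inE => /orP[/eqP->|/eqP->].
  by rewrite inE => /orP[/eqP->|/eqP->].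
have Rtr x y z : R x y -> R y z -> R x z.
  move=> xy yz.
  have [|m [mE mP]] := Rmin (fun m => [\/ m = x, m = y | m = z]).
    by exists x; apply: Or31.
  have [mx my mz] : [/\ R m x, R m y & R m z].
    by split; apply: mP; [apply: Or31|apply: Or32|apply: Or33].
  case: mE => mE; rewrite mE in mx my mz *; first exact: mz.
    by rewrite (Ranti x y).
  by rewrite -(Ranti y z).
exists (fun x y => R x y /\ x <> y); split.
- move=> x; apply: contrapT => nA.
  have [|z [nz zP]] := Rmin (fun x => ~ Acc (fun x y => R x y /\ x <> y) x).
    by exists x.
  apply: nz; constructor=> y [yz ne]; apply: contrapT => /zP zy.
  by apply: ne; apply: Ranti.
- move=> u v w [uv nuv] [vw nvw]; split; first exact: Rtr vw.
  by move=> uw; rewrite -uw in vw; apply: nuv; apply: Ranti.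
- move=> v w; have [->|/eqP ne] := eqVneq v w; first exact: Or32.
  case: (Rtot v w) => ?; [apply: Or31|apply: Or33]; split=> //.
  by move/esym.
Qed.

(** * Finite torsion sets of scalars *)

Section FiniteType.
Context {S : pzRingType} (C : lmodType S).
Hypothesis Ccot : cotilting C.

(** The power of [C] modulo bounded functions is torsion-free by the lifting criterion, and [z],
    being nowhere zero, has a nonzero class there. *)
Lemma unbounded_separated (W : Type) (lt : W -> W -> Prop) (z : W -> C) :
  well_founded lt -> (forall u v w, lt u v -> lt v w -> lt u w) ->
  (forall v w, [\/ lt v w, v = w | lt w v]) -> (forall w, exists v, lt w v) ->
  inhabited W -> (forall w, z w <> 0) ->
  exists f : (W -> C) -> C, [/\ is_hom f, (forall y, bounded lt y -> f y = 0)
    & f z <> 0].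
Proof.
move=> wf ltt lttot ltnm iW znz.
have [[E0 [E1 [d0 [d1 [E0i E1i dex]]]]] Cpow _] := Ccot.
have [B [q [qh qs qP]]] := quotient_exists (bounded_submod C ltt lttot iW).
have Bs : separated C B.
  apply/(inCf_separated Ccot)/(Ext1_zero_of_lift E0i dex) => u uh.
  have [|s [sh sb sE]] := bounded_hom_lift E1i dex Cpow wf ltt lttot ltnm (hom_comp uh qh).
    by move=> y /qP ->; rewrite hom0.
  have [|v [vh vE]] := factor_epi qh qs sh; first by move=> x /qP/sb.
  by exists v; split=> // x; have [y <-] := qs x; rewrite vE sE.
have : ~ torrad C (q z).
  move=> /Bs/qP[w zw]; apply: (znz w); apply: zw => ww.
  by elim/(well_founded_ind wf): w ww => w IH /[dup]/IH.
move=> /existsNP[f /not_implyP[fh fz]].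
exists (fun y => f (q y)); split=> //; first exact: hom_comp.
by move=> y /qP ->; rewrite hom0.
Qed.

(** Equivalently, [S] modulo the left ideal generated by [A] has no nonzero map to [C]. *)
Definition torsion_set (A : S -> Prop) :=
  forall z : C, (forall r, A r -> r *: z = 0) -> z = 0.

Lemma torsion_setS (A A' : S -> Prop) :
  (forall r, A r -> A' r) -> torsion_set A -> torsion_set A'.
Proof. by move=> AA' At z zA; apply: At => r /AA'/zA. Qed.

(** Let [I] be a least initial segment such that [A] within [I], enlarged by finitely many elements
    of [A], is a torsion set. It is empty: a largest element could be moved to the finite part, and
    without one the nonzero elements killed by shorter segments form a sequence that yields a
    nonzero element killed by the whole set. *)
Lemma torsion_set_finite (A : S -> Prop) : torsion_set A ->
  exists s : seq S, {in s, forall r, A r} /\ torsion_set (fun r => r \in s).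
Proof.
move=> At.
have [lt [wf ltt lttot]] := well_founded_total_order S.
pose ok (I : S -> Prop) := exists s : seq S, {in s, forall r, A r} /\
   torsion_set (fun r => (A r /\ I r) \/ r \in s).
suff [I [Iok Idown Imin]] : exists I, [/\ ok I, (forall b c, I b -> lt c b -> I c)
    & forall b, I b -> ~ ok (lt^~ b)].
  have [s [sA st]] := Iok.
  have [[b0 Ib0]|nI] := pselect (exists b, I b); last first.
    exists s; split=> //; apply: torsion_setS st => r [[_ Ir]|//].
    by case: nI; exists r.
  exfalso.
  have [[b [Ib bmax]]|nomax] := pselect (exists b, I b /\ forall c, I c -> ~ lt b c).
    apply: (Imin b Ib).
    have Ilt r : I r -> lt r b \/ r = b.
      by move=> /bmax nbr; case: (lttot r b) => //; [left|right].
    have [Ab|nAb] := pselect (A b).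
      exists (b :: s); split; first by move=> r; rewrite inE => /orP[/eqP->//|/sA].
      apply: torsion_setS st => r [[Ar /Ilt[rb|->]]|rs]; first by left.
        by right; rewrite mem_head.
      by right; rewrite inE rs orbT.
    exists s; split=> //; apply: torsion_setS st => r [[Ar /Ilt[rb|rb]]|rs].
    - by left.
    - by case: nAb; rewrite -rb.
    - by right.
  pose W := {b : S | I b}.
  pose ltW (u v : W) := lt (sval u) (sval v).
  have wfW : well_founded ltW.
    move=> [b Ib]; elim/(well_founded_ind wf): b Ib => b IH Ib.
    by constructor=> -[c Ic] /IH.
  have ztW (w : W) : exists z : C, z <> 0 /\
      forall r, (A r /\ lt r (sval w)) \/ r \in s -> r *: z = 0.
    apply: contrapT => noz; apply: (Imin (sval w) (svalP w)); exists s; split=> //.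
    by move=> z zP; apply: contrapT => nz; apply: noz; exists z.
  have [z zP] := choice ztW.
  have nomaxI b : I b -> exists c, I c /\ lt b c.
    move=> Ib; apply: contrapT => no; apply: nomax; exists b; split=> // c Ic bc.
    by apply: no; exists c.
  have [||||w|f [fh fb fz]] := @unbounded_separated W ltW z wfW.
  - by move=> u v w; apply: ltt.
  - move=> [v Iv] [w Iw]; case: (lttot v w) => vw; [exact: Or31| |exact: Or33].
    by apply: Or32; apply: eq_exist.
  - by move=> [b Ib]; have [c [Ic bc]] := nomaxI b Ib; exists (exist _ c Ic).
  - by split; exists b0.
  - by case: (zP w).
  (* Multiplication by [r] kills [z] from some level above [r] on, and [f] ignores bounded
     sequences. *)
  apply: fz; apply: st => r Hr; rewrite -homZ //; apply: fb.
  case: Hr => [[Ar Ir]|rs]; last first.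
    exists (exist _ b0 Ib0) => v _; have [_ vP] := zP v.
    by rewrite -[LHS]/(r *: z v) vP //; right.
  have [c [Ic rc]] := nomaxI r Ir; exists (exist _ c Ic) => -[v Iv] nvc.
  have [_ vP] := zP (exist _ v Iv); rewrite -[LHS]/(r *: z _) vP //; left; split=> //=.
  by case: (lttot v c) => [//|->//|cv]; apply: ltt cv.
have [ex|no] := pselect (exists a, ok (lt^~ a)).
  have [a [aok amin]] := well_founded_min wf ex.
  exists (lt^~ a); split=> // [b c ba cb|b ba bok]; first exact: ltt ba.
  exact: amin bok ba.
exists (fun _ => True); split=> //; last by move=> b _ bok; apply: no; exists b.
by exists [::]; split=> //; apply: torsion_setS At => r; left.
Qed.

End FiniteType.

(** * Injective envelopes *)

(** Maximising over sets whose union with [A0] satisfies [P] keeps the result above [A0] and takes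
    care of the empty chain. *)
Lemma Zorn_above (T : Type) (P : set (set T)) (A0 : set T) : P A0 ->
  (forall F : set (set T), (exists A, F A) -> (forall A, F A -> P A) ->
     (forall A B, F A -> F B -> (forall x, A x -> B x) \/ (forall x, B x -> A x)) ->
     P (fun x => exists2 A, F A & A x)) ->
  exists A, [/\ P A, (forall x, A0 x -> A x)
    & forall B, P B -> (forall x, A x -> B x) -> forall x, B x -> A x].
Proof.
move=> PA0 Pch.
have [|A [PA Amax]] := @Zorn_bigcup T (fun A => P (A `|` A0)%classic).
  move=> F FP Ftot; have [[A1 FA1]|nF] := pselect (exists A, F A); last first.
    suff -> : (\bigcup_(X in F) X = set0)%classic by rewrite set0U.
    by rewrite -classical_sets.subset0 => x [A FA]; case: nF; exists A.
  have -> : (\bigcup_(X in F) X `|` A0)%classic =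
      (fun x => exists2 A, (fun A => exists2 B, F B & A = (B `|` A0)%classic) A & A x).
    apply/seteqP; split=> x.
      move=> [[A FA Ax]|A0x]; last by exists (A1 `|` A0)%classic; [exists A1|right].
      by exists (A `|` A0)%classic; [exists A|left].
    by move=> [_ [A FA ->] [Ax|?]]; [left; exists A|right].
  apply: Pch; first by exists (A1 `|` A0)%classic, A1.
    by move=> _ [A FA ->]; apply: FP.
  move=> _ _ [A FA ->] [B FB ->].
  by case: (Ftot _ _ FA FB) => AB; [left|right] => x [/AB ?|?]; [left|right|left|right].
exists (A `|` A0)%classic; split=> // [x ?|B PB AB x Bx]; first by right.
apply: contrapT => nAx; apply: (Amax B).
  split; first by move=> y Ay; apply: AB; left.
  by move=> BA; apply: nAx; left; apply: BA.
suff -> : (B `|` A0)%classic = B by [].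
by apply/seteqP; split=> y; [case=> // ?; apply: AB; right|left].
Qed.

Section Envelope.
Context {S : pzRingType}.
Local Notation mod := (lmodType S).

Lemma chain_union_submod (M : mod) (F : (M -> Prop) -> Prop) :
  (exists A, F A) -> (forall A, F A -> is_submod A) ->
  (forall A B, F A -> F B -> (forall x, A x -> B x) \/ (forall x, B x -> A x)) ->
  is_submod (fun x => exists2 A, F A & A x).
Proof.
move=> [A0 FA0] Fs Ftot; split=> [|r x y [A FA Ax] [B FB By]].
  by exists A0 => //; apply: (Fs _ FA0).1.
case: (Ftot _ _ FA FB) => AB.
  by exists B => //; apply: (Fs _ FB).2 => //; apply: AB.
by exists A => //; apply: (Fs _ FA).2 => //; apply: AB.
Qed.

(** Inside [G], [Y] is a maximal essential extension of the image of [X], and [Z] a maximal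
    submodule meeting [Y] in zero. A map from [G] modulo [Z] to [G] that is the identity on [Y]
    again has a range essential over the image of [X], hence equal to [Y]; so [Y] is a retract of
    [G]. *)
Lemma injective_envelope_exists (X G : mod) (e : X -> G) :
  is_hom e -> injective e -> injective_mod G ->
  exists (Y : mod) (j : X -> Y), injective_envelope j.
Proof.
move=> eh ei Gi.
pose im y := exists x, e x = y.
pose ess (A : G -> Prop) := [/\ is_submod A, (forall y, im y -> A y)
  & forall L : G -> Prop, is_submod L -> (forall y, L y -> im y -> y = 0) ->
      forall y, A y -> L y -> y = 0].
have [||Y [[Ys Yim Yess] _ Ymax]] := @Zorn_above G ess im.
- by split=> //; [apply: hom_im_submod|move=> L _ + y ? ?; apply].
- move=> F [A0 FA0] Fe Ftot; split.
  + by apply: chain_union_submod => //; [exists A0|move=> A /Fe[]].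
  + by move=> y yim; exists A0 => //; have [_ + _] := Fe _ FA0; apply.
  + by move=> L Ls Lim y [A /Fe[_ _ Ae] Ay] Ly; apply: Ae Ly.
have [Y' [eY [eYh eYi eYP]]] := submodule_exists Ys.
pose dis (Z : G -> Prop) := is_submod Z /\ forall y, Z y -> Y y -> y = 0.
have [||Z [[Zs Zdis] _ Zmax]] := @Zorn_above G dis (fun y => y = 0).
- by split=> //; split=> // r x y -> ->; rewrite scaler0 addr0.
- move=> F Fn Fd Ftot; split; last by move=> y [A /Fd[_ Ad] Ay]; apply: Ad.
  by apply: chain_union_submod => // A /Fd[].
have [B [q [qh qs qP]]] := quotient_exists Zs.
have YeY y : Y (eY y) by apply/eYP; exists y.
have qei : injective (fun y => q (eY y)).
  apply: (hom_inj (hom_comp qh eYh)) => y /qP Zy.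
  by apply: (inj_hom0 eYh eYi); apply: Zdis.
have [r [rh rE]] := Gi _ _ _ eY (hom_comp qh eYh) qei eYh.
have rqh := hom_comp rh qh.
have rqE y : Y y -> r (q y) = y by move=> /eYP[y' <-].
have imrq : ess (fun y => exists g, r (q g) = y).
  split; first exact: hom_im_submod rqh.
    by move=> y yim; exists y; apply: rqE; apply: Yim.
  move=> L Ls Lim _ [g <-] Lg.
  have /qP -> : Z g; last by rewrite hom0.
  apply: (Zmax (fun g => L (r (q g)))) => //.
    split; first exact: submod_preim.
    by move=> y Ly Yy; move: Ly; rewrite rqE // => Ly; apply: (Yess L).
  by move=> z /qP ->; rewrite hom0 //; apply: Ls.1.
have [|p [ph pE]] := factor_mono eYh eYi rqh.
  move=> g; apply/eYP; apply: (Ymax _ imrq); last by exists g.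
  by move=> y Yy; exists y; apply: rqE.
have [|j [jh jE]] := factor_mono eYh eYi eh.
  by move=> x; apply/eYP/Yim; exists x.
exists Y', j; split=> //.
- by move=> x x' /(congr1 eY); rewrite !jE => /ei.
- apply: (injective_mod_retract eYh ph _ Gi) => y.
  by apply: eYi; rewrite pE rE.
- move=> L Ls Lj y Ly; apply: (inj_hom0 eYh eYi).
  apply: (Yess _ (submod_im eYh Ls)) => //; last by exists y.
  move=> _ [y' Ly' <-] [x xE]; rewrite (Lj y') ?hom0 //.
  by exists x; apply: eYi; rewrite jE.
Qed.

(** The kernel of [s] meets the essential submodule [Q] in zero, so [s] has a left inverse; this
    also fixes [Q] and is injective for the same reason. *)
Lemma essential_endo_bijective (Q E : mod) (i : Q -> E) (s : E -> E) :
  injective_envelope i -> is_hom s -> (forall x, s (i x) = i x) ->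
  bijective s.
Proof.
move=> [ih ii Ei iess] sh si.
have sinj : injective s.
  apply: (hom_inj sh); apply: (iess _ (hom_ker_submod sh)) => _ /[swap] -[x <-].
  by rewrite si.
have [t [th tE]] := Ei _ _ s id sh sinj (@hom_id _ _).
exists t => // y; apply/eqP; rewrite -subr_eq0; apply/eqP.
apply: (iess _ (hom_ker_submod th)); last by rewrite homB // tE subrr.
by move=> _ /[swap] -[x <-]; rewrite -[X in t X]si tE.
Qed.

End Envelope.

(** * Envelopes and covers for a hereditary pair *)

Section Hereditary.
Context {S : pzRingType} (C : lmodType S).
Local Notation mod := (lmodType S).
Hypotheses (Ccot : cotilting C) (Cher : hereditary C).

(** A map from [X] to [C] need not extend to [M]; instead its value at [x] is killed by the
    annihilator of the torsion element [e x], hence zero. *)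
Lemma torrad_separated (M X : mod) (e : X -> M) x : is_hom e -> injective e ->
  separated C X -> torrad C (e x) -> x = 0.
Proof.
move=> eh ei Xs Rx; apply: Xs => f fh; apply: (torrad_elt Ccot Cher Rx) => r.
by rewrite -!homZ // => /(inj_hom0 eh ei) ->; rewrite hom0.
Qed.

Lemma separated_envelope (X Y : mod) (j : X -> Y) :
  injective_envelope j -> separated C X -> separated C Y.
Proof.
move=> [jh ji _ jess] Xs; apply: jess; first exact: torrad_submod.
by move=> _ /[swap] -[x <-] /(torrad_separated jh ji Xs) ->; rewrite hom0.
Qed.

Lemma cover_injective (X E : mod) (c : X -> E) :
  injective_mod E -> is_cover (inCf C) c -> injective_mod X.
Proof.
move=> Ei [XC ch cpre cmin].
have [_ _ [C1 [C0 [I [_ [_ [_ _ Ii Ic _]]]]]]] := Ccot.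
pose J := {f : X -> I | is_hom f}.
pose e (x : X) : J -> I := fun j => sval j x.
have eh : is_hom e by apply: hom_fun => -[].
have ei : injective e.
  apply: (hom_inj eh) => x ex; apply: contrapT => /Ic[f [fh]]; apply.
  by have /(congr1 (@^~ (exist _ f fh))) := ex.
have [Y [j jenv]] := injective_envelope_exists eh ei (injective_mod_fun (J := J) Ii).
have Ys := separated_envelope jenv (iffLR (inCf_separated Ccot X) XC).
have [jh ji Yi _] := jenv.
have [c' [c'h c'E]] := Ei _ _ j c jh ji ch.
have [h [hh hE]] := cpre Y c' (iffRL (inCf_separated Ccot Y) Ys) c'h.
have hjh := hom_comp hh jh.
have [|t tK Kt] := cmin _ hjh; first by move=> x; rewrite hE c'E.
apply: (injective_mod_retract jh _ _ Yi (p := fun y => t (h y))) => //.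
apply: hom_comp => // r x y; apply: (can_inj tK).
by rewrite Kt hjh !Kt.
Qed.

Lemma cover_surj (X E : mod) (c : X -> E) : is_cover (inCf C) c -> surj c.
Proof.
move=> [XC ch cpre _] y; have [id1 _ _] := Ccot.
have [h [hh hE]] := cpre (S^o : mod) _ (Ext1_zero_regular id1) (hom_scale y).
by exists (h 1); rewrite hE scale1r.
Qed.

End Hereditary.

(** * Double character duals *)

Lemma int_subgroup_principal (K : int -> Prop) :
  K 0 -> (forall k l, K k -> K l -> K (k - l)) ->
  exists n : nat, forall k, K k <-> exists q : int, k = q * n%:Z.
Proof.
move=> K0 KB.
have KN k : K k -> K (- k) by move=> Kk; rewrite -sub0r; apply: KB.
have KD k l : K k -> K l -> K (k + l).
  by move=> Kk Kl; rewrite -[l]opprK; apply: KB => //; apply: KN.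
have Kabs k : K k -> K `|k|%N%:Z.
  by case: k => n // /KN; rewrite NegzE opprK.
have KMn k (n : nat) : K k -> K (k *+ n).
  by move=> Kk; elim: n => [|n IH]; rewrite ?mulr0n // mulrS; apply: KD.
have KM (q k : int) : K k -> K (q * k).
  move=> Kk; have Kn (m : nat) : K (m%:Z * k) by rewrite -natz mulr_natl; apply: KMn.
  by case: q => m //; rewrite NegzE mulNr; apply: KN.
have [[n0 [n0p Kn0]]|no] := pselect (exists n : nat, (0 < n)%N /\ K n%:Z); last first.
  exists 0%N => k; split=> [Kk|[q ->]]; last by rewrite mulr0.
  exists 0; rewrite mulr0; apply/eqP; apply: contra_notT no => k0.
  by exists `|k|%N; rewrite absz_gt0; split=> //; apply: Kabs.
have ex : exists n, (0 < n)%N && `[< K n%:Z >].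
  by exists n0; rewrite n0p; apply/asboolP.
case: (ex_minnP ex) => n /andP[np /asboolP Kn] nmin.
exists n => k; split=> [Kk|[q ->]]; last exact: KM.
exists (k %/ n)%Z; have kE := divz_eq k n.
suff r0 : (k %% n)%Z = 0 by rewrite {1}kE r0 addr0.
have Kr : K (k %% n)%Z.
  have -> : (k %% n)%Z = k - (k %/ n)%Z * n by rewrite {2}kE addrAC subrr add0r.
  by apply: KB => //; apply: KM.
have n0' : n%:Z != 0 by rewrite -lt0n in np *; case: (n) np.
apply/eqP; apply: contraTT (ltz_mod k n0') => rn0.
rewrite -leNgt -(gez0_abs (modz_ge0 k n0')) -abszE lez_nat; apply: nmin.
rewrite absz_gt0 rn0; apply/asboolP; exact: Kabs.
Qed.

Definition additive_fun (G D : zmodType) (h : G -> D) :=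
  forall x y, h (x + y) = h x + h y.

Section AdditiveFun.
Variables (G D : zmodType) (h : G -> D).
Hypothesis ha : additive_fun h.
Lemma additive_fun0 : h 0 = 0.
Proof. by have /eqP := ha 0 0; rewrite addr0 addrC -subr_eq subrr => /eqP. Qed.
Lemma additive_funN x : h (- x) = - h x.
Proof. by apply/eqP; rewrite -addr_eq0 -ha addNr additive_fun0. Qed.
Lemma additive_fun_sum (I : Type) (s : seq I) (F : I -> G) :
  h (\sum_(i <- s) F i) = \sum_(i <- s) h (F i).
Proof. exact: (big_morph h ha additive_fun0). Qed.
End AdditiveFun.

(** * Extension of additive maps into divisible groups *)

Section Divisible.
Variable D : zmodType.
Hypothesis Ddiv : forall (n : nat) (d : D), (0 < n)%N -> exists d', d' *+ n = d.

(** The graph of an additive map on a subgroup of [G]; the last clause makes it single-valued. *)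
Definition subgraph (G : zmodType) (A : G * D -> Prop) :=
  [/\ A 0, (forall p p', A p -> A p' -> A (p - p')) & forall d, A (0, d) -> d = 0].

Lemma subgraph_mulrz (G : zmodType) (A : G * D -> Prop) p (k : int) :
  subgraph A -> A p -> A (p *~ k).
Proof.
move=> [A0 AB _] Ap.
have AN q : A q -> A (- q) by move=> Aq; rewrite -sub0r; apply: AB.
have AD q q' : A q -> A q' -> A (q + q').
  by move=> Aq Aq'; rewrite -[q']opprK; apply: AB => //; apply: AN.
have An n : A (p *+ n) by elim: n => [|n IH]; rewrite ?mulr0n // mulrS; apply: AD.
by case: (intP k) => [|n|n]; rewrite ?mulr0z // ?mulrNz -?pmulrn //; apply: AN.
Qed.

Lemma subgraph_adjoin (G : zmodType) (A : G * D -> Prop) (b : G) (e : D) :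
  subgraph A -> (forall k d, A (b *~ k, d) -> d = e *~ k) ->
  subgraph (fun p => exists q k, A q /\ p = q + (b, e) *~ k).
Proof.
move=> Asub AE; have [A0 AB Af] := Asub; split.
- by exists 0, 0; rewrite mulr0z addr0.
- move=> _ _ [q [k [Aq ->]]] [q' [k' [Aq' ->]]]; exists (q - q'), (k - k').
  by split; [apply: AB|rewrite mulrzBr opprD addrACA].
- move=> d [[x d1] [k [Aq]]].
  have pairz (k0 : int) : (b, e) *~ k0 = (b *~ k0, e *~ k0).
    by rewrite [LHS]surjective_pairing !raddfMz.
  rewrite pairz => -[/esym/eqP]; rewrite addr_eq0 => /eqP xE ->.
  have : A (b *~ k, - d1).
    have := AB _ _ A0 Aq; rewrite sub0r.
    have -> : - (x, d1) = (- x, - d1) :> G * D by [].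
    by rewrite xE opprK.
  by move=> /AE <-; rewrite subrr.
Qed.

Lemma divisible_extend (G : zmodType) (A : G * D -> Prop) : subgraph A ->
  exists h : G -> D, additive_fun h /\ forall x d, A (x, d) -> h x = d.
Proof.
move=> Asub.
have [||M [Msub AM Mmax]] := @Zorn_above _ (@subgraph G) A.
- exact: Asub.
- move=> F [A1 FA1] Fs Ftot; split.
  + by exists A1 => //; have [] := Fs _ FA1.
  + move=> p p' [B FB Bp] [B' FB' Bp'].
    case: (Ftot _ _ FB FB') => BB.
      by exists B' => //; have [_ + _] := Fs _ FB'; apply=> //; apply: BB.
    by exists B => //; have [_ + _] := Fs _ FB; apply=> //; apply: BB.
  + by move=> d [B /Fs[_ _ Bf] Bd]; apply: Bf.
have [M0 MB Mf] := Msub.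
have Mfun x d d' : M (x, d) -> M (x, d') -> d = d'.
  move=> H H'; have := MB _ _ H H'.
  have -> : (x, d) - (x, d') = (x - x, d - d') :> G * D by [].
  rewrite subrr => /Mf/eqP.
  by rewrite subr_eq0 => /eqP.
have /choice[h hP] b : exists d, M (b, d).
  (* The multiples of [b] in the domain are those of [b *~ n]; divisibility gives a value at [b]
     compatible with the one at [b *~ n]. *)
  have [||n nP] := @int_subgroup_principal (fun k => exists d, M (b *~ k, d)).
  - by exists 0; rewrite mulr0z.
  - move=> k l [d Hd] [d' Hd']; exists (d - d'); rewrite mulrzBr.
    exact: (MB _ _ Hd Hd').
  have [d0 Md0] : exists d, M (b *~ n, d) by apply/nP; exists 1; rewrite mul1r.
  have [e eE] : exists e, e *+ n = d0.
    case: (n) Md0 => [|m] Md0; last exact: Ddiv.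
    by exists 0; apply: (Mfun 0) => //; rewrite mulr0z in Md0.
  have M'sub : subgraph (fun p => exists q k, M q /\ p = q + (b, e) *~ k).
    apply: subgraph_adjoin => // k d Mkd.
    have /nP[q kE] : exists d, M (b *~ k, d) by exists d.
    apply: (Mfun (b *~ k)) => //; rewrite kE mulrC.
    have := subgraph_mulrz q Msub Md0.
    by rewrite [_ *~ q]surjective_pairing !raddfMz /= -eE pmulrn -!mulrzA.
  exists e; apply: (Mmax _ M'sub).
    by move=> p Mp; exists p, 0; rewrite mulr0z addr0.
  by exists 0, 1; rewrite mulr1z add0r.
exists h; split=> [x y|x d Axd]; last exact: Mfun (hP x) (AM _ Axd).
apply: (Mfun (x + y)) => //.
have := MB _ _ (hP x) (MB _ _ M0 (hP y)).
by rewrite sub0r opprK.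
Qed.

Hypothesis Dtor : forall n : nat, (1 < n)%N -> exists d : D, d <> 0 /\ d *+ n = 0.

Lemma divisible_separate (G : zmodType) (H : G -> Prop) (x : G) :
  H 0 -> (forall y z, H y -> H z -> H (y - z)) -> ~ H x ->
  exists h : G -> D, [/\ additive_fun h, (forall y, H y -> h y = 0) & h x <> 0].
Proof.
move=> H0 HB nHx.
have [||n nP] := @int_subgroup_principal (fun k => H (x *~ k)).
- by rewrite mulr0z.
- by move=> k l Hk Hl; rewrite mulrzBr; apply: HB.
(* [n] is the order of [x] modulo [H], with 0 for infinite order, where any nonzero [e] serves;
   [n = 1] would put [x] in [H]. *)
have [e [e0 en]] : exists e : D, e <> 0 /\ e *+ n = 0.
  case: (n) nP => [|[|m]] nP; last exact: Dtor.
    by have [e [e0 _]] := Dtor (n := 2) isT; exists e.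
  by case: nHx; rewrite -[x]mulr1z; apply/nP; exists 1.
have Asub : subgraph (fun p : G * D => H p.1 /\ p.2 = 0).
  split=> // [p p' [Hp p0] [Hp' p'0]|d [_ //]].
  by split; [apply: HB|rewrite /= p0 p'0 subrr].
have [|h [ha hE]] := @divisible_extend G _ (subgraph_adjoin (b := x) (e := e) Asub _).
  move=> k d [/= /nP[q ->] ->].
  by rewrite mulrC mulrzA -pmulrn en mul0rz.
exists h; split=> // [y Hy|].
  by apply: hE; exists (y, 0), 0; rewrite mulr0z addr0.
suff -> : h x = e by [].
by apply: hE; exists 0, 1; rewrite mulr1z add0r.
Qed.

End Divisible.

Lemma rat_mod_int_exists : exists D : zmodType,
  (forall (n : nat) (d : D), (0 < n)%N -> exists d', d' *+ n = d) /\
  (forall n : nat, (1 < n)%N -> exists d : D, d <> 0 /\ d *+ n = 0).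
Proof.
have Zs : @is_submod int (zmodule rat) (fun x => exists k : int, x = k%:~R :> rat).
  split; first by exists 0.
  move=> r _ _ [k ->] [l ->]; exists (r * k + l); rewrite scalezrE.
  by rewrite intrD intrM mulrC mulrzr.
have [D [q [qh qs qP]]] := quotient_exists Zs.
have qMn x n : q (x *+ n) = q x *+ n by rewrite -!scaler_nat homZ.
exists D; split=> [n d n0|n n1].
  have [x <-] := qs d; exists (q ((x : rat) / n%:R)); rewrite -qMn; congr q.
  by rewrite -[LHS](mulr_natr (x / n%:R : rat)) divfK // pnatr_eq0 -lt0n.
exists (q (n%:R^-1 : rat)); split.
  move=> /qP[k kE]; have n0 : (n%:R : rat) != 0 by rewrite pnatr_eq0; case: (n) n1.
  have : (k * n)%:~R = 1%:~R :> rat by rewrite intrM -kE -[(n : int)%:~R]/(n%:R) mulVf.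
  move=> /intr_inj/(congr1 absz); rewrite abszM /= => /eqP.
  by rewrite muln_eq1 => /andP[_ /eqP nn]; rewrite nn in n1.
rewrite -qMn; apply/qP; exists 1; rewrite -[LHS](mulr_natr (n%:R^-1 : rat)) mulVf //.
by rewrite pnatr_eq0; case: (n) n1.
Qed.

Section Characters.
Variables (G D : zmodType).

Definition chr_pred : {pred G -> D} := fun f => `[< additive_fun f >].

Lemma chr_zmod_closed : zmod_closed chr_pred.
Proof.
split=> [|f g /asboolP fa /asboolP ga]; apply/asboolP => x y.
  by rewrite -[LHS]/(0 : D) -[RHS]/(0 + 0 : D) addr0.
rewrite -[LHS]/(f (x + y) - g (x + y)) -[RHS]/(f x - g x + (f y - g y)).
by rewrite fa ga opprD addrACA.
Qed.
HB.instance Definition _ :=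
  GRing.isZmodClosed.Build (G -> D) chr_pred chr_zmod_closed.

Record chr := Chr {chr_val :> G -> D; _ : chr_val \in chr_pred}.
HB.instance Definition _ := [isSub for chr_val].
HB.instance Definition _ := [Choice of chr by <:].
HB.instance Definition _ := [SubChoice_isSubZmodule of chr by <:].

Lemma chr_additive (f : chr) : additive_fun f.
Proof. by case: f => f fa; apply: (elimT (asboolP _) fa). Qed.

Definition mkchr (h : G -> D) (ha : additive_fun h) : chr :=
  Chr (introT (asboolP _) ha : h \in chr_pred).

Lemma chrP (f g : chr) : (forall x, f x = g x) -> f = g.
Proof. by move=> E; apply/val_inj/funext. Qed.

Lemma chr_sum (I : Type) (s : seq I) (F : I -> chr) x :
  (\sum_(i <- s) F i) x = \sum_(i <- s) F i x.
Proof. by elim/big_ind2: _ => // f y g z <- <-. Qed.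

End Characters.

Definition single (I : eqType) (M : zmodType) (i : I) (m : M) : I -> M :=
  fun k => if k == i then m else 0.

Lemma single_additive (I : eqType) (M : zmodType) (i : I) :
  additive_fun (single i : M -> (I -> M)).
Proof.
move=> x y; apply/funext => k; rewrite -[RHS]/(single i x k + single i y k) /single.
by case: eqP => // _; rewrite addr0.
Qed.

Lemma sum_single (I : finType) (M : zmodType) (y : I -> M) :
  y = \sum_i single i (y i).
Proof.
apply/funext => k; have ->: (\sum_i single i (y i)) k = \sum_i single i (y i) k.
  by elim/big_ind2: _ => // f y' g z <- <-.
rewrite (bigD1 k) //= /single eqxx big1 ?addr0 // => i.
by rewrite eq_sym => /negbTE ->.
Qed.

Section DoubleDual.
Context {S : pzRingType} (D : zmodType).
Local Notation mod := (lmodType S).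
Local Notation chrD M := (chr M D).

Section Action.
Variable M : mod.
Lemma chr_act_additive (r : S) (x : chrD M) : additive_fun (fun m => x (r *: m)).
Proof. by move=> m m'; rewrite scalerDr chr_additive. Qed.
Definition chr_act r x : chrD M := mkchr (chr_act_additive r x).
Lemma chr_actD r : additive_fun (chr_act r). Proof. by move=> x y; apply: chrP. Qed.

Definition ddual : Type := chr (chrD M) D.
HB.instance Definition _ := GRing.Zmodule.on ddual.

Lemma ddual_scale_additive (r : S) (u : ddual) :
  additive_fun (fun x => (u : chr _ _) (chr_act r x)).
Proof. by move=> x y; rewrite chr_actD chr_additive. Qed.
Definition ddual_scale r u : ddual := mkchr (ddual_scale_additive r u).

Lemma ddual_scaleA a b v : ddual_scale a (ddual_scale b v) = ddual_scale (a * b) v.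
Proof.
apply: chrP => x; rewrite /=; congr (chr_val v _).
by apply: chrP => m /=; rewrite scalerA.
Qed.
Lemma ddual_scale1 : left_id 1 ddual_scale.
Proof.
move=> v; apply: chrP => x; rewrite /=; congr (chr_val v _).
by apply: chrP => m /=; rewrite scale1r.
Qed.
Lemma ddual_scaleDr : right_distributive ddual_scale +%R.
Proof. by move=> a u v; apply: chrP. Qed.
Lemma ddual_scaleDl v : {morph ddual_scale^~ v : a b / a + b}.
Proof.
move=> a b; apply: chrP => x.
rewrite -[RHS]/(chr_val v (chr_act a x) + chr_val v (chr_act b x)) -chr_additive.
by congr (chr_val v _); apply: chrP => m /=; rewrite scalerDl chr_additive.
Qed.
HB.instance Definition _ := GRing.Zmodule_isLmodule.Build S ddual
  ddual_scaleA ddual_scale1 ddual_scaleDr ddual_scaleDl.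

Lemma ev_additive (m : M) : additive_fun (fun x : chrD M => x m).
Proof. by []. Qed.
Definition ev (m : M) : ddual := mkchr (ev_additive m).
Lemma ev_hom : is_hom ev.
Proof.
move=> r m m'; apply: chrP => x /=.
by rewrite -[RHS]/(x (r *: m) + x m') chr_additive.
Qed.
End Action.

Lemma chr_comp_additive (M M' : mod) (h : M -> M') (hh : is_hom h) (x : chrD M') :
  additive_fun (fun m => x (h m)).
Proof. by move=> m m'; rewrite homD // chr_additive. Qed.

Lemma ddual_map (M M' : mod) (h : M -> M') : is_hom h ->
  exists h2 : ddual M -> ddual M', is_hom h2 /\ forall m, h2 (ev m) = ev (h m).
Proof.
move=> hh; pose pb (x : chrD M') : chrD M := mkchr (chr_comp_additive hh x).
have h2a (u : ddual M) : additive_fun (fun x => (u : chr _ _) (pb x)).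
  by move=> x y; rewrite -chr_additive; congr (chr_val u _); apply: chrP.
exists (fun u => mkchr (h2a u)); split=> [r u v|m]; last exact: chrP.
apply: chrP => x.
rewrite -[LHS]/(chr_val u (chr_act r (pb x)) + chr_val v (pb x)).
rewrite -[RHS]/(chr_val u (pb (chr_act r x)) + chr_val v (pb x)).
by congr (chr_val u _ + _); apply: chrP => m /=; rewrite homZ.
Qed.

Hypothesis Ddiv : forall (n : nat) (d : D), (0 < n)%N -> exists d', d' *+ n = d.
Hypothesis Dtor : forall n : nat, (1 < n)%N -> exists d : D, d <> 0 /\ d *+ n = 0.

(** If the right-hand side [a] were not solvable in [M], a character [h] would kill all solvable
    right-hand sides but not [a]. Its components solve the transposed homogeneous system, so a
    solution in the double dual would force [h a = 0]. *)
Lemma ev_pure (M : mod) : pure_mono (@ev M).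
Proof.
split; first exact: ev_hom.
  apply: (hom_inj (@ev_hom M)) => x ex; apply: contrapT => x0.
  have [||h [ha _ hx]] := divisible_separate Ddiv Dtor (H := fun y => y = 0) _ _ x0.
  - by [].
  - by move=> y z -> ->; rewrite subrr.
  apply: hx; exact: (congr1 (fun u : ddual M => chr_val u (mkchr ha)) ex).
move=> m n r a [xb xbE]; apply: contrapT => na.
pose H (y : 'I_n -> M) := exists xa : 'I_m -> M, forall i, \sum_(j < m) r i j *: xa j = y i.
have H0 : H 0 by exists 0 => i; rewrite big1 // => j _; rewrite scaler0.
have HB y z : H y -> H z -> H (y - z).
  move=> [p pE] [q qE]; exists (p - q) => i.
  rewrite -[RHS]/(y i - z i) -pE -qE -sumrB; apply: eq_bigr => j _.
  by rewrite -scalerBr.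
have [h [ha hH hx]] := divisible_separate Ddiv Dtor H0 HB na.
have xia i : additive_fun (fun m => h (single i m)).
  by move=> p q; rewrite single_additive ha.
pose x i := mkchr (xia i).
have hE (y : 'I_n -> M) : h y = \sum_i x i (y i).
  by rewrite {1}(sum_single y) additive_fun_sum.
apply: hx; rewrite hE.
transitivity (\sum_(i < n) \sum_(j < m) chr_val (xb j) (chr_act (r i j) (x i))).
  apply: eq_bigr => i _.
  have := congr1 (fun u : ddual M => chr_val u (x i)) (xbE i).
  rewrite /= => <-; exact: chr_sum.
rewrite exchange_big big1 //= => j _.
rewrite -(additive_fun_sum (@chr_additive _ _ (xb j))).
rewrite -[RHS](additive_fun0 (@chr_additive _ _ (xb j))); congr (chr_val (xb j) _).
apply: chrP => p; rewrite chr_sum /=.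
rewrite -(hE (fun i => r i j *: p)); apply: hH; exists (single j p) => i.
rewrite (bigD1 j) //= /single eqxx big1 ?addr0 // => k /negbTE ->.
by rewrite scaler0.
Qed.

End DoubleDual.

(** * Local retractions of pure embeddings *)

Section LocalRetraction.
Context {S : pzRingType} (N B : lmodType S) (f : N -> B).
Hypothesis fp : pure_mono f.

Lemma pure_mono_seq m (eqs : seq (('I_m -> S) * N)) (xb : 'I_m -> B) :
  all (fun e => `[< \sum_j e.1 j *: xb j = f e.2 >]) eqs ->
  exists xa : 'I_m -> N, all (fun e => `[< \sum_j e.1 j *: xa j = e.2 >]) eqs.
Proof.
pose e0 : ('I_m -> S) * N := (fun=> 0, 0).
move=> /(all_nthP e0) H; have [_ _ pur] := fp.
have [|xa xaE] := pur m (size eqs) (fun i => (nth e0 eqs i).1) (fun i => (nth e0 eqs i).2).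
  by exists xb => i; apply/asboolP/H.
by exists xa; apply/(all_nthP e0) => i ilt; apply/asboolP/(xaE (Ordinal ilt)).
Qed.

(** A bare function that finitely many linearity conditions and finitely many elements cannot tell
    from a retraction of [f]. *)
Definition local_retraction (s : seq (S * B * B)) (t : seq N) (th : B -> N) :=
  (forall p, p \in s -> th (p.1.1 *: p.1.2 + p.2) = p.1.1 *: th p.1.2 + th p.2) /\
  (forall n, n \in t -> th (f n) = n).

(** The finitely many elements of [B] involved solve a linear system with right-hand sides from [N];
    purity gives a solution in [N], whose entries are the values of [th]. *)
Lemma local_retraction_exists s t : exists th, local_retraction s t th.
Proof.
pose vs (p : S * B * B) := [:: p.1.2; p.2; p.1.1 *: p.1.2 + p.2].
pose v := undup (flatten [seq vs p | p <- s] ++ [seq f n | n <- t]).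
pose del (b : B) (j : 'I_(size v)) : S := (nth 0 v j == b)%:R.
have delE b : b \in v -> \sum_j del b j *: (nth 0 v j) = b.
  move=> bv; rewrite -(big_mkord xpredT (fun j => (nth 0 v j == b)%:R *: nth 0 v j)).
  rewrite -(big_nth 0 xpredT (fun x => (x == b)%:R *: x)).
  rewrite (bigD1_seq b) ?undup_uniq //= eqxx scale1r big1 ?addr0 // => x /negbTE ->.
  by rewrite scale0r.
pose co (p : S * B * B) j := p.1.1 * del p.1.2 j + del p.2 j - del (p.1.1 *: p.1.2 + p.2) j.
have coE (V : lmodType S) (p : S * B * B) (y : 'I_(size v) -> V) :
    \sum_j co p j *: y j = p.1.1 *: (\sum_j del p.1.2 j *: y j) +
      \sum_j del p.2 j *: y j - \sum_j del (p.1.1 *: p.1.2 + p.2) j *: y j.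
  rewrite scaler_sumr -big_split -sumrB /=; apply: eq_bigr => j _.
  by rewrite scalerBl scalerDl scalerA.
pose eqs := [seq (co p, 0 : N) | p <- s] ++ [seq (del (f n), n) | n <- t].
have [|xa] := @pure_mono_seq _ eqs (fun j => nth 0 v j).
  have [fh _ _] := fp.
  rewrite all_cat !all_map; apply/andP; split; apply/allP => p ps; apply/asboolP => /=.
    have vsv x : x \in vs p -> x \in v.
      move=> xp; rewrite mem_undup mem_cat; apply/orP; left; apply/flattenP.
      by exists (vs p) => //; apply: map_f.
    by rewrite coE !delE ?subrr ?hom0 //; apply: vsv; rewrite !inE eqxx ?orbT.
  by rewrite delE // mem_undup mem_cat map_f ?orbT.
rewrite all_cat !all_map => /andP[/allP H1 /allP H2].
exists (fun b => \sum_j del b j *: xa j); split=> [p /H1|n /H2] /asboolP //=.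
by rewrite coE => /eqP; rewrite subr_eq0 => /eqP.
Qed.
End LocalRetraction.

(** * Pure-injectivity and torsion-freeness of double duals *)

Section DoubleDualPureInjective.
Context {S : pzRingType} (D : zmodType).
Local Notation mod := (lmodType S).
Hypothesis Ddiv : forall (n : nat) (d : D), (0 < n)%N -> exists d', d' *+ n = d.

(* A retraction of [f : ddual M -> B] is a balanced pairing of [B] with
   [chr M D]; it is obtained by extending to all of [B -> chr M D] the pairing
   forced by [f] on formal sums, consistent because purity provides retractions
   respecting any finite set of relations. *)
Lemma ddual_pure_injective (M : mod) : pure_injective (ddual D M).
Proof.
move=> B f fp.
pose L := chr M D.
pose evs (th : B -> ddual D M) (v : seq B) (g : B -> L) : D :=
  \sum_(b <- v) chr_val (th b) (g b).
have evs_add th v : additive_fun (evs th v).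
  move=> g g'; rewrite /evs -big_split /=; apply: eq_bigr => b _.
  exact: chr_additive.
have evsB th v g g' : evs th v (g - g') = evs th v g - evs th v g'.
  by rewrite evs_add (additive_funN (evs_add th v)).
have evs1 th v b l : uniq v -> b \in v -> evs th v (single b l) = chr_val (th b) l.
  move=> uv bv; rewrite /evs (bigD1_seq b) //= /single eqxx big1 ?addr0 //.
  by move=> b' /negbTE ->; apply: (additive_fun0 (@chr_additive _ _ _)).
(* [A] relates a function to [d] when every good enough local retraction, summed over any large
   enough finite list, pairs the function to [d]; [s], [t] and [v0] say what is enough. *)
pose A (p : (B -> L) * D) := exists s t (v0 : seq B), forall th, local_retraction f s t th ->
  forall v, uniq v -> {subset v0 <= v} -> evs th v p.1 = p.2.
have Asub : subgraph A.
  split.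
  - exists [::], [::], [::] => th _ v _ _; exact: (additive_fun0 (evs_add th v)).
  - move=> p p' [s [t [v0 H]]] [s' [t' [v0' H']]].
    exists (s ++ s'), (t ++ t'), (v0 ++ v0') => th [th1 th2] v uv vv.
    rewrite evsB (H th) ?(H' th) // => [|b bv||b bv].
    + by split=> [q qs|n nt]; [apply: th1|apply: th2]; rewrite mem_cat ?qs ?nt orbT.
    + by apply: vv; rewrite mem_cat bv orbT.
    + by split=> [q qs|n nt]; [apply: th1|apply: th2]; rewrite mem_cat ?qs ?nt.
    + by apply: vv; rewrite mem_cat bv.
  (* Purity enters here: some local retraction exists, and it pairs the zero function to 0. *)
  - move=> d [s [t [v0 H]]]; have [th thP] := local_retraction_exists fp s t.
    have /= <- := H th thP (undup v0) (undup_uniq v0) _.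
      exact: (additive_fun0 (evs_add _ _)).
    by move=> b; rewrite mem_undup.
have [h [ha hA]] := divisible_extend Ddiv Asub.
have rhoa b : additive_fun (fun l : L => h (single b l)).
  by move=> l l'; rewrite single_additive ha.
exists (fun b => mkchr (rhoa b) : ddual D M); split=> [r b b'|n].
  apply: chrP => l.
  rewrite -[LHS]/(h (single (r *: b + b') l)).
  rewrite -[RHS]/(h (single b (chr_act r l)) + h (single b' l)) -ha.
  apply/eqP; rewrite -subr_eq0 -(additive_funN ha) -ha; apply/eqP.
  apply: hA; exists [:: (r, b, b')], [::], [:: r *: b + b'; b; b'] => th [th1 _] v uv vv.
  rewrite evsB evs_add !evs1 //; try by apply: vv; rewrite !inE eqxx ?orbT.
  have /= -> := th1 (r, b, b') (mem_head _ _).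
  by rewrite -[X in X - _]/(chr_val (th b) (chr_act r l) + chr_val (th b') l) subrr.
apply: chrP => l; apply: hA.
exists [::], [:: n], [:: f n] => th [_ th2] v uv vv /=.
rewrite evs1 //; last by apply: vv; rewrite mem_head.
by rewrite th2 ?mem_head.
Qed.

Variable C : mod.
Hypotheses (Ccot : cotilting C) (Cher : hereditary C).

(** The annihilator of a torsion element [u] contains a finite torsion set [s]. Multiplication by
    the elements of [s] embeds [M] into a finite power, so a character [x] extends there and is a
    sum of characters multiplied by elements of [s]; [u] vanishes on each summand. *)
Lemma ddual_separated (M : mod) : separated C M -> separated C (ddual D M).
Proof.
move=> Ms u Ru.
have [s [su st]] := torsion_set_finite Ccot
  (A := fun r => r *: u = 0) (fun z => torrad_elt Ccot Cher Ru).
apply: chrP => x.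
pose g (m : M) : 'I_(size s) -> M := fun i => nth 0 s i *: m.
have ga : additive_fun g.
  by move=> m m'; apply/funext => i; rewrite /g scalerDr.
have gB m m' : g m - g m' = g (m - m').
  by rewrite ga (additive_funN ga).
have [|h [ha hA]] := divisible_extend Ddiv
    (A := fun p : ('I_(size s) -> M) * D => exists m, p = (g m, x m)).
  split.
  - by exists 0; rewrite (additive_fun0 ga) (additive_fun0 (chr_additive x)).
  - move=> _ _ [m ->] [m' ->]; exists (m - m').
    rewrite -gB (chr_additive x m) (additive_funN (chr_additive x)) //.
  - move=> d [m [/esym gm ->]].
    suff -> : m = 0 by rewrite (additive_fun0 (chr_additive x)).
    apply: Ms => k kh; apply: st => r rs; rewrite -homZ //.
    have ilt : (index r s < size s)%N by rewrite index_mem.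
    have := congr1 (@^~ (Ordinal ilt)) gm.
    by rewrite /g /= nth_index // => ->; rewrite hom0.
have xia i : additive_fun (fun m => h (single i m)).
  by move=> p q; rewrite single_additive ha.
have -> : x = \sum_(i < size s) chr_act (nth 0 s i) (mkchr (xia i)).
  apply: chrP => m; rewrite chr_sum /=.
  rewrite -(hA (g m) (x m)); last by exists m.
  by rewrite {1}(sum_single (g m)) additive_fun_sum.
rewrite (additive_fun_sum (chr_additive u)) big1 // => i _.
have : nth 0 s i *: u = 0 by apply: su; apply: mem_nth.
by move=> /(congr1 (fun w : ddual D M => chr_val w (mkchr (xia i)))).
Qed.

End DoubleDualPureInjective.

(** * Covers of simple torsion modules *)

Section Pullback.
Context {S : pzRingType}.
Local Notation mod := (lmodType S).
Variables (F X Q E : mod) (j : F -> X) (b : F -> Q) (c : X -> E) (i : Q -> E).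
Hypotheses (pb : is_pullback j b c i) (ih : is_hom i) (ii : injective i).

(** Elements are maps from the regular module, to which the uniqueness of the pullback property
    applies. *)
Lemma pullback_injective : injective j.
Proof.
have [jh bh cj uni] := pb; move=> z z' jz.
have bz : b z = b z' by apply: ii; rewrite -!cj jz.
have [||r|w [_ _ _ wU]] := uni (S^o : mod) (fun r => j ((r : S) *: z)) (fun r => b ((r : S) *: z)).
- by apply: hom_comp => //; apply: hom_scale.
- by apply: hom_comp => //; apply: hom_scale.
- exact: cj.
have := wU _ (hom_scale z) (fun=> erefl) (fun=> erefl) 1; rewrite scale1r => ->.
have := wU _ (hom_scale z') _ _ 1; rewrite scale1r => -> // r.
  by rewrite !homZ // jz.
by rewrite !homZ // bz.
Qed.

Lemma pullback_lift (x : X) (q : Q) : is_hom c -> c x = i q ->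
  exists z, j z = x /\ b z = q.
Proof.
have [jh bh cj uni] := pb; move=> ch cx.
have [r|w [_ wj wb _]] := uni (S^o : mod) _ _ (hom_scale x) (hom_scale q).
  by rewrite !homZ // cx.
by exists (w 1); rewrite wj wb !scale1r.
Qed.

Lemma pullback_kernel (K : mod) (k : K -> X) (a : K -> F) : is_hom c -> is_kernel k c ->
  is_hom a -> (forall x, j (a x) = k x) -> (forall x, b (a x) = 0) -> is_kernel a b.
Proof.
have [jh bh cj uni] := pb; move=> ch [kh ki kP] ah ja ba; split=> //.
  by move=> x y /(congr1 j); rewrite !ja => /ki.
move=> z; split=> [bz|[y <-//]].
have /kP[y yE] : c (j z) = 0 by rewrite cj bz hom0.
by exists y; apply: pullback_injective; rewrite ja.
Qed.

(** A submodule of [X] meeting [F] in zero has an image in [E] meeting [Q] in zero, hence lies in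
    the kernel of [c], which is inside [F]. *)
Lemma pullback_essential : is_hom c ->
  injective_envelope i -> injective_mod X -> injective_envelope j.
Proof.
have [jh bh cj uni] := pb; move=> ch [_ _ _ iess] Xi; split=> //.
  exact: pullback_injective.
move=> P Ps Pj y Py; apply: (Pj) => //.
have cy : c y = 0.
  apply: (iess _ (submod_im ch Ps)); last by exists y.
  move=> _ [x Px <-] [q qE]; have [z [jz bz]] := pullback_lift ch (esym qE).
  by rewrite (Pj x) ?hom0 //; exists z.
by have [|z [jz _]] := @pullback_lift y 0 ch; [rewrite hom0|exists z].
Qed.

Lemma pullback_cover (inX : mod -> Prop) : injective_envelope i ->
  is_cover inX c -> surj c -> inX F -> injective_mod X -> is_cover inX b.
Proof.
have [jh bh cj uni] := pb; move=> ienv [XC ch cpre cmin] cs FC Xi; split=> //.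
  move=> Y g YC gh; have [u [uh uE]] := cpre Y _ YC (hom_comp ih gh).
  by have [w [wh _ wb _]] := uni Y u g uh gh uE; exists w.
move=> g gh bg.
(* The extension [g'] of [g] to the injective [X] preserves the kernel of [c], so it induces [s] on
   [E]; as [s] fixes [Q] it is an automorphism. *)
have [g' [g'h g'E]] := Xi _ _ j (fun z => j (g z)) jh pullback_injective (hom_comp jh gh).
have [|s [sh sE]] := factor_epi ch cs (hom_comp ch g'h).
  move=> x cx; have [|z [<- bz]] := @pullback_lift x 0 ch; first by rewrite hom0.
  by rewrite g'E cj bg bz hom0.
have si q : s (i q) = i q.
  have [x xE] := cs (i q); have [z [jz bz]] := pullback_lift ch xE.
  by rewrite -xE sE -jz g'E !cj bg.
have [s' sK s'K] := essential_endo_bijective ienv sh si.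
have s'h : is_hom s' by move=> r x y; apply: (can_inj sK); rewrite s'K sh !s'K.
(* [g'] lies over [s], not over the identity; [h] lies over the inverse of [s], so both composites
   lie over the identity of [E] and are automorphisms by minimality. *)
have [h [hh hE]] := cpre X _ XC (hom_comp s'h ch).
have [t tK Kt] : bijective (fun x => h (g' x)).
  by apply: cmin => [|x]; [exact: hom_comp|rewrite hE -sE sK].
have [t' t'K Kt'] : bijective (fun x => g' (h x)).
  by apply: cmin => [|x]; [exact: hom_comp|rewrite -sE hE s'K].
have g'inj : injective g' by move=> x y /(congr1 (fun x => t (h x))); rewrite !tK.
have g'surj y : exists x, g' x = y by exists (h (t' y)); rewrite Kt'.
have ginj : injective g.
  by move=> z z' /(congr1 j); rewrite -!g'E => /g'inj/pullback_injective.
have /choice[gi giE] y : exists z, g z = y.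
  have [x xE] := g'surj (j y).
  have cx : c x = i (b y) by rewrite -(sK (c x)) sE xE cj -{1}si sK.
  have [z [jz bz]] := pullback_lift ch cx; exists z; apply: pullback_injective.
  by rewrite -g'E jz.
by exists gi => // z; apply: ginj; rewrite giE.
Qed.

End Pullback.

(** * The kernel of the cover *)

Section Main.
Context {S : pzRingType} (C : lmodType S).
Local Notation mod := (lmodType S).
Hypotheses (Ccot : cotilting C) (Cher : hereditary C).

(** A retraction of [a] yields a section of [b], but a map from the torsion [Q] to the torsion-free
    [F] is zero. *)
Lemma kernel_not_split (Q F K : mod) (b : F -> Q) (a : K -> F) :
  is_cover (inCf C) b -> is_kernel a b -> inQt C Q -> (exists q : Q, q <> 0) ->
  ~ split_mono a.
Proof.
move=> bcov [ah ai aP] Qt [q q0] [r [rh rE]].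
have [FC bh _ _] := bcov; have bs := cover_surj Ccot bcov.
have [|s [sh sE]] := factor_epi bh bs (hom_sub (@hom_id _ F) (hom_comp ah rh)).
  by move=> _ /aP[x <-]; rewrite rE subrr.
have [y yE] := bs q; apply: q0.
have /eqP : y - a (r y) = 0.
  apply: (iffLR (inCf_separated Ccot F) FC) => f fh.
  by rewrite -sE; apply: (Qt _ (hom_comp fh sh)).
by rewrite subr_eq0 => /eqP ya; rewrite -yE; apply/aP; exists (r y).
Qed.

(* Push the cover out along [g]: either the pushout is torsion-free, and then
   minimality of the cover splits [g], or its torsion part is a copy of [Q]
   complementing [Z], which yields the factorization. *)
Lemma cover_kernel_left_almost_split (Q F K : mod) (b : F -> Q) (a : K -> F) :
  is_cover (inCf C) b -> is_kernel a b -> inQt C Q -> simple_mod Q ->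
  left_almost_split (inCf C) a.
Proof.
move=> bcov aker Qt [Q0 Qs].
have [FC bh bpre bmin] := bcov; have [ah ai aP] := aker.
have ba x : b (a x) = 0 by apply/aP; exists x.
have sep M := inCf_separated Ccot M.
split=> //.
- exact/sep/(separated_mono ah ai)/sep.
- exact: kernel_not_split bcov aker Qt Q0.
move=> Z g ZC gh ngs.
have relh : is_hom (fun x => (g x, - a x) : (Z * F)%type).
  apply: hom_pair => // r x y; rewrite ah opprD scalerN //.
have [F' [q [qh qs qP]]] := quotient_exists (hom_im_submod relh).
pose iota (z : Z) := q (z, 0); pose kap (y : F) := q (0, y).
have iotah : is_hom iota.
  by apply: (hom_comp qh); apply: hom_pair => //; apply: hom_cst0.
have kaph : is_hom kap.
  by apply: (hom_comp qh); apply: hom_pair => //; apply: hom_cst0.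
have iota_kap x : iota (g x) = kap (a x).
  apply/eqP; rewrite -subr_eq0 -(homB qh); apply/eqP/qP; exists x.
  by apply: injective_projections; rewrite /= ?subr0 ?sub0r.
have iotai : injective iota.
  apply: (hom_inj iotah) => z /qP[x [<- /eqP]].
  by rewrite oppr_eq0 => /eqP/(inj_hom0 ah ai) ->; rewrite hom0.
have [|pi [pih piE]] := factor_epi qh qs (hom_comp bh (@hom_snd _ Z F)).
  by move=> _ /qP[x <-]; rewrite /= homN // ba oppr0.
have pi_iota z : pi (iota z) = 0 by rewrite piE /= hom0.
have pi_kap y : pi (kap y) = b y by rewrite piE.
have ker_pi w : pi w = 0 -> exists z, iota z = w.
  have [[z y] <-] := qs w; rewrite piE /= => /aP[x xE]; exists (z + g x).
  apply/eqP; rewrite -subr_eq0 -(homB qh); apply/eqP/qP; exists x.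
  by apply: injective_projections; rewrite /= ?sub0r ?xE // [z + _]addrC addrK.
have [F's|/existsNP[w /not_implyP[wR w0]]] := pselect (separated C F').
  case: ngs.
  (* A torsion-free pushout maps to [F] over [Q]; after correction by the automorphism [t] this is
     the identity on [F], and its restriction to [Z] retracts [g]. *)
  have [h [hh hE]] := bpre F' pi (iffRL (sep F') F's) pih.
  have hkh := hom_comp hh kaph.
  have [|t tK Kt] := bmin _ hkh; first by move=> y; rewrite hE pi_kap.
  have th : is_hom t by move=> r x y; apply: (can_inj tK); rewrite Kt hkh !Kt.
  have bt y : b (t y) = b y by rewrite -{2}(Kt y) hE pi_kap.
  have [|r [rh rE]] := factor_mono ah ai (hom_comp th (hom_comp hh iotah)).
    by move=> z; apply/aP; rewrite bt hE pi_iota.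
  by exists r; split=> // x; apply: ai; rewrite rE iota_kap tK.
(* The torsion part [A] of [F'] meets the kernel [Z] of [pi] in zero, so it embeds in the simple
   [Q]; being nonzero it maps onto [Q], and its inverse [s] splits [pi]. *)
have [A [e [eh ei eP]]] := submodule_exists (torrad_submod C F').
have pieh := hom_comp pih eh.
have pie0 y : pi (e y) = 0 -> y = 0.
  move=> /ker_pi[z zE]; apply: (inj_hom0 eh ei); rewrite -zE.
  have zR : torrad C (iota z) by rewrite zE; apply/eP; exists y.
  by rewrite (torrad_separated Ccot Cher iotah iotai (iffLR (sep Z) ZC) zR) hom0.
have pies : surj (fun y => pi (e y)).
  case: (Qs _ (hom_im_submod pieh)) => // H.
  have /eP[y yE] := wR; case: w0; rewrite -yE.
  by have -> : y = 0 by [apply: pie0; apply: H; exists y]; rewrite hom0.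
have [|s [sh sE]] := factor_epi pieh pies eh; first by move=> y /pie0 ->; rewrite hom0.
have pis x : pi (s x) = x by have [y <-] := pies x; rewrite sE.
have [|h [hh hE]] := factor_mono iotah iotai (hom_sub kaph (hom_comp sh bh)).
  by move=> y; apply: ker_pi; rewrite homB // pi_kap pis subrr.
exists h; split=> // x; apply: iotai.
by rewrite hE ba hom0 // subr0 iota_kap.
Qed.

Lemma cover_kernel_pure_injective (X E K : mod) (c : X -> E) (k : K -> X) :
  injective_mod X -> is_cover (inCf C) c -> is_kernel k c -> pure_injective K.
Proof.
move=> Xi [XC ch cpre _] [kh ki kP] M f fp; have [fh fi pur] := fp.
have [u [uh uE]] := Xi _ _ f k fh fi kh.
pose P (x : M) := forall g : M -> C, is_hom g -> (forall y, g (f y) = 0) -> g x = 0.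
have Ps : is_submod P.
  split=> [g gh _|r x y Px Py g gh gf]; first by rewrite hom0.
  by rewrite gh Px // Py // scaler0 addr0.
have [B [q [qh qs qP]]] := quotient_exists Ps.
have Bs : separated C B.
  by apply: (separated_quotient qh qs qP) => x Hx g gh gf; apply: Hx => // y; apply.
have cuP x : P x -> c (u x) = 0.
  move=> Px; have [N [p [ph ps pP]]] := quotient_exists (hom_im_submod fh).
  have Rpx : torrad C (p x).
    move=> g gh; apply: (Px _ (hom_comp gh ph)) => y.
    have /pP -> : exists y', f y' = f y by exists y.
    by rewrite hom0.
  (* The scalars carrying [x] into the image of [f] annihilate a torsion element, so finitely many
     of them form a torsion set. *)
  have [s [sx st]] := torsion_set_finite Ccot (A := fun r => exists y, f y = r *: x)
    (fun z zP => torrad_elt Ccot Cher Rpx (fun r rpx =>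
       zP r (iffLR (pP _) (etrans (homZ ph r x) rpx)))).
  have /choice[y yE] (l : 'I_(size s)) : exists y, f y = nth 0 s l *: x.
    by apply: sx; apply: mem_nth.
  (* Purity in one unknown: some element of [K] agrees with [x] under all scalars in [s], so [s]
     kills the difference, and [u] sends it to zero, [X] being torsion-free. *)
  have [|xa xaE] := pur 1%N (size s) (fun l _ => nth 0 s l) y.
    by exists (fun=> x) => l; rewrite big_ord1 yE.
  have ux : u (x - f (xa ord0)) = 0.
    apply: (iffLR (inCf_separated Ccot X) XC) => g gh; apply: st => r rs.
    have ilt : (index r s < size s)%N by rewrite index_mem.
    rewrite -homZ // -homZ // scalerBr.
    have := xaE (Ordinal ilt); have := yE (Ordinal ilt).
    rewrite big_ord1 /= nth_index // => yE' xaE'.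
    by rewrite -[r *: f _]homZ // xaE' yE' subrr !hom0.
  move: ux; rewrite homB // uE => /eqP; rewrite subr_eq0 => /eqP ->.
  by apply/kP; exists (xa ord0).
have [|w [wh wE]] := factor_epi qh qs (hom_comp ch uh); first by move=> x /qP/cuP.
have [v [vh vE]] := cpre B w (iffRL (inCf_separated Ccot B) Bs) wh.
(* Subtracting the lift brings [u] into [K]; the lift vanishes on the image of [f], where [u] agrees
   with [k]. *)
have [|r [rh rE]] := factor_mono kh ki (hom_sub uh (hom_comp vh qh)).
  by move=> x; apply/kP; rewrite homB // vE wE subrr.
exists r; split=> // y; apply: ki; rewrite rE uE.
have /qP -> : P (f y) by move=> g _; apply.
by rewrite hom0 // subr0.
Qed.

(** With both summands nonzero, neither projection is injective, so both factor through [a], and the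
    sum of the factorisations would split [a]. For [K] zero, [a] would split trivially. *)
Lemma left_almost_split_indecomposable (K F : mod) (a : K -> F) :
  left_almost_split (inCf C) a -> indecomposable K.
Proof.
move=> [KC FC ah nas afac]; split.
  apply: contrapT => noK; apply: nas; exists (fun=> 0); split; first exact: hom_cst0.
  by move=> x; apply: contrapT => x0; apply: noK; exists x => /esym.
move=> P1 P2 P1s P2s P12 Pdec.
have [/asboolP|/asboolPn /existsNP[x1 /not_implyP[Px1 x10]]] :=
  boolP `[< forall x, P1 x -> x = 0 >]; first by left.
have [/asboolP|/asboolPn /existsNP[x2 /not_implyP[Px2 x20]]] :=
  boolP `[< forall x, P2 x -> x = 0 >]; first by right.
exfalso.
have /choice[p pP] x : exists y, P1 y /\ P2 (x - y).
  have [y [z [Py Pz ->]]] := Pdec x.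
  by exists y; rewrite addrC addKr.
have pU x y : P1 y -> P2 (x - y) -> p x = y.
  move=> Py Pxy; have [Ppx Pxp] := pP x.
  apply/eqP; rewrite -subr_eq0; apply/eqP; apply: P12; first exact: submodB.
  by have := submodB P2s Pxy Pxp; rewrite opprB addrC addrA subrK.
have ph : is_hom p.
  move=> r x y; have [H1 H2] := pP x; have [H3 H4] := pP y.
  apply: pU; first exact: P1s.2.
  by rewrite opprD addrACA -scalerBr; apply: P2s.2.
have p1 : p x1 = x1 by apply: pU => //; rewrite subrr; apply: P2s.1.
have p2 : p x2 = 0 by apply: pU; [exact: P1s.1|rewrite subr0].
have [|h1 [h1h h1E]] := afac K p KC ph.
  move=> [g [gh gE]]; apply: x20; by rewrite -(gE x2) p2 hom0.
have [|h2 [h2h h2E]] := afac K (fun x => x - p x) KC (hom_sub (@hom_id _ K) ph).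
  move=> [g [gh gE]]; apply: x10; by rewrite -(gE x1) p1 subrr hom0.
apply: nas; exists (fun y => h1 y + h2 y); split; first exact: hom_add.
by move=> x; rewrite h1E h2E addrC subrK.
Qed.

(* The simple cokernel of [a] embeds in the cokernel of [ev \o a], so the latter
   is not torsion-free although [F] itself may fail to be pure-injective. *)
Lemma cover_kernel_special_neg_isolated (Q F K : mod) (b : F -> Q) (a : K -> F) :
  is_cover (inCf C) b -> is_kernel a b -> inQt C Q -> simple_mod Q ->
  pure_injective K -> special_neg_isolated C K.
Proof.
move=> bcov aker Qt Qs Kpi.
have [KC FC ah nas afac] := cover_kernel_left_almost_split bcov aker Qt Qs.
have sep M := inCf_separated Ccot M.
have [D [Ddiv Dtor]] := rat_mod_int_exists.
have evh M := @ev_hom S D M.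
have evp M : pure_mono (@ev S D M) := ev_pure Ddiv Dtor M.
split=> //; exists (ddual D F), (fun x => ev D (a x)); split.
  split=> //.
  - split; first exact: ddual_pure_injective.
    by apply/sep/(ddual_separated Ddiv Ccot Cher)/sep.
  - exact: hom_comp.
  - move=> [r [rh rE]]; apply: nas; exists (fun y => r (ev D y)).
    by split=> //; apply: hom_comp.
  (* The factorisation through [F] passes to double duals and returns by a retraction of [ev] on the
     pure-injective [Z]. *)
  move=> Z g [Zpi ZC] gh ngs; have [h [hh hE]] := afac Z g ZC gh ngs.
  have [h2 [h2h h2E]] := ddual_map D hh.
  have [r [rh rE]] := Zpi _ _ (evp Z).
  exists (fun y => r (h2 y)); split; first exact: hom_comp.
  by move=> x; rewrite h2E rE.
have [Y [q [qh qs qP]]] := quotient_exists (hom_im_submod (hom_comp (evh F) ah)).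
exists Y, q; split; first by split.
move=> /sep Ys; have [_ bh _ _] := bcov; have bs := cover_surj Ccot bcov.
have [_ _ aP] := aker; have [[x x0] _] := Qs; have [y yE] := bs x.
have [|s [sh sE]] := factor_epi bh bs (hom_comp qh (evh F)).
  by move=> _ /aP[z <-]; apply/qP; exists z.
have /qP[z zE] : q (ev D y) = 0.
  by apply: Ys => f fh; rewrite -sE; apply: (Qt _ (hom_comp fh sh)).
have [_ evi _] := evp F; move/evi: zE => zE.
by apply: x0; rewrite -yE; apply/aP; exists z.
Qed.

End Main.

(* Right R-modules = left modules over the converse ring R^c. *)
Theorem theorem6p4 (R : nzRingType) (C : lmodType (R^c)%type) :
  cotilting C -> hereditary C ->
  forall (Q E X K : lmodType (R^c)%type)
         (i : Q -> E) (c : X -> E) (k : K -> X),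
  inQt C Q -> simple_mod Q -> injective_envelope i ->
  is_cover (inCf C) c -> is_kernel k c ->
  forall (F : lmodType (R^c)%type) (j : F -> X) (b : F -> Q) (a : K -> F),
  is_pullback j b c i ->
  is_hom a -> (forall x, j (a x) = k x) -> (forall x, b (a x) = 0) ->
  [/\ is_cover (inCf C) b,
      is_kernel a b,
      injective_envelope j,
      left_almost_split (inCf C) a &
      [/\ special_neg_isolated C K, indecomposable K & pure_injective K]].
Proof.
move=> Ccot Cher Q E X K i c k Qt Qs ienv ccov kker F j b a pb ah ja ba.
have [ih ii Ei _] := ienv; have [XC ch _ _] := ccov; have [jh _ _ _] := pb.
have Xi := cover_injective Ccot Cher Ei ccov.
have aker := pullback_kernel pb ih ii ch kker ah ja ba.
have ji := pullback_injective pb ii.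
have FC : inCf C F.
  exact/(inCf_separated Ccot)/(separated_mono jh ji)/(inCf_separated Ccot).
have bcov := pullback_cover pb ih ii ienv ccov (cover_surj Ccot ccov) FC Xi.
have las := cover_kernel_left_almost_split Ccot Cher bcov aker Qt Qs.
have Kpi := cover_kernel_pure_injective Ccot Cher Xi ccov kker.
split=> //; first exact: pullback_essential pb ih ii ch ienv Xi.
split=> //; last exact: left_almost_split_indecomposable las.
exact (cover_kernel_special_neg_isolated Ccot Cher bcov aker Qt Qs Kpi).
Qed.
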